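(* Let $\mu,\nu\in\mathbb{H}$ satisfy $\mu^2=\nu^2=-1$, let $a=\mu\nu+\nu\mu$ (which is a real number), let $\mathcal{F}^{\mu,\nu}$ be the associated left quaternion Fourier transform, and let $f,g:\mathbb{R}^2\to\mathbb{H}$ be integrable quaternion functions. Then the classical convolution of $f$ and $g$ is expressed in terms of Mustard convolutions by $$\begin{aligned} f*g={}&\frac14\Big[f*_{\mu,\nu}g+f*_{\mu,\nu}g^{(0,1)}+f*_{\mu,\nu}g^{(1,0)}+f*_{\mu,\nu}g^{(1,1)}\\ &\quad-\nu f*_{\mu,\nu}\nu g+\nu f*_{\mu,\nu}\nu g^{(0,1)}-\nu f*_{\mu,\nu}\nu g^{(1,0)}+\nu f*_{\mu,\nu}\nu g^{(1,1)}\\ &\quad-\mu f^{(0,1)}*_{\mu,\nu}\mu g-\mu f^{(0,1)}*_{\mu,\nu}\mu g^{(0,1)}+\mu f^{(0,1)}*_{\mu,\nu}\mu g^{(1,0)}+\mu f^{(0,1)}*_{\mu,\nu}\mu g^{(1,1)}\\ &\quad+\mu\nu f^{(0,1)}*_{\mu,\nu}\nu\mu g-\mu\nu f^{(0,1)}*_{\mu,\nu}\nu\mu g^{(0,1)}-\mu\nu f^{(0,1)}*_{\mu,\nu}\nu\mu g^{(1,0)}+\mu\nu f^{(0,1)}*_{\mu,\nu}\nu\mu g^{(1,1)}\Big]\\ &+\frac a8\Big[-f*_{\mu,\nu}\mu\nu g+\nu f*_{\mu,\nu}\mu g+f*_{\mu,\nu}\mu\nu g^{(0,1)}+\nu f*_{\mu,\nu}\mu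 g^{(0,1)}\\ &\quad+f*_{\mu,\nu}\mu\nu g^{(1,0)}-\nu f*_{\mu,\nu}\mu g^{(1,0)}-f*_{\mu,\nu}\mu\nu g^{(1,1)}-\nu f*_{\mu,\nu}\mu g^{(1,1)}\\ &\quad+f^{(0,1)}*_{\mu,\nu}\mu\nu g-\nu f^{(0,1)}*_{\mu,\nu}\mu g-f^{(0,1)}*_{\mu,\nu}\mu\nu g^{(0,1)}-\nu f^{(0,1)}*_{\mu,\nu}\mu g^{(0,1)}\\ &\quad-f^{(0,1)}*_{\mu,\nu}\mu\nu g^{(1,0)}+\nu f^{(0,1)}*_{\mu,\nu}\mu g^{(1,0)}+f^{(0,1)}*_{\mu,\nu}\mu\nu g^{(1,1)}+\nu f^{(0,1)}*_{\mu,\nu}\mu g^{(1,1)}\Big]\\ &+\frac{a^2}8\Big[f*_{\mu,\nu}g-f*_{\mu,\nu}g^{(0,1)}-f*_{\mu,\nu}g^{(1,0)}+f*_{\mu,\nu}g^{(1,1)}\\ &\quad-f^{(0,1)}*_{\mu,\nu}g+f^{(0,1)}*_{\mu,\nu}g^{(0,1)}+f^{(0,1)}*_{\mu,\nu}g^{(1,0)}-f^{(0,1)}*_{\mu,\nu}g^{(1,1)}\Big]. \end{aligned}$$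
   Context: $\mathbb{H}$ is the algebra of real quaternions. Quaternion functions are functions $f=f_0+f_1\boldsymbol{i}+f_2\boldsymbol{j}+f_3\boldsymbol{k}:\mathbb{R}^2\to\mathbb{H}$ with $f_0,f_1,f_2,f_3\in L^1(\mathbb{R}^2)$ real-valued; equalities between such functions are almost everywhere. For $q\in\mathbb{H}$, $qf$ is the pointwise left multiple. Parentheses are omitted: $\nu f*_{\mu,\nu}\nu g^{(0,1)}$ means $(\nu f)*_{\mu,\nu}(\nu g^{(0,1)})$, and similarly for all terms. Reflections: for $\phi=(\phi_1,\phi_2)\in\{0,1\}^2$, $f^{\phi}(x)=f((-1)^{\phi_1}x_1,(-1)^{\phi_2}x_2)$. Exponential: for $\mu^2=-1$ and $\theta\in\mathbb{R}$, $e^{\mu\theta}=\cos\theta+\mu\sin\theta$. Left quaternion Fourier transform: $\mathcal{F}^{\mu,\nu}(f)(y)=\frac{1}{2\pi}\int_{\mathbb{R}^2}e^{-\mu x_1y_1}e^{-\nu x_2y_2}f(x)\,dx$. Its inverse is formally $(\mathcal{F}^{\mu,\nu})^{-1}(h)(y)=\frac1{2\pi}\int_{\mathbb{R}^2}e^{\nu x_2y_2}e^{\mu x_1y_1}h(x)\,dx$. Classical convolution: $(f*g)(x)=\int_{\mathbb{R}^2}f(y)g(x-y)\,dy$ (quaternion product in the integrand). Mustard convolution: $f*_{\mu,\nu}g:=2\pi(\mathcal{F}^{\mu,\nu})^{-1}\big(\mathcal{F}^{\mu,\nu}(f)\,\mathcal{F}^{\mu,\nu}(g)\big)$, with the pointwise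 quaternion product. For integrable $f,g$ this is understood as the unique integrable quaternion function $h$ with $\mathcal{F}^{\mu,\nu}(h)=2\pi\,\mathcal{F}^{\mu,\nu}(f)\mathcal{F}^{\mu,\nu}(g)$ (such an $h$ always exists). *)

(* Defs.v *)
From HB Require Import structures.
From mathcomp Require Import all_boot all_order all_algebra ring.
From mathcomp Require Import all_classical all_reals all_analysis.

Set Implicit Arguments.
Unset Strict Implicit.
Unset Printing Implicit Defensive.
Import Order.TTheory GRing.Theory Num.Theory.
Import numFieldNormedType.Exports.
Local Open Scope classical_set_scope.
Local Open Scope ring_scope.

Record quat (R : Type) := Quat { qre : R; qi : R; qj : R; qk : R }.

Section quat_choice.
Variable R : realType.

Definition quat_tuple (q : quat R) := (qre q, qi q, qj q, qk q).
Definition tuple_quat (t : R * R * R * R) :=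
  Quat t.1.1.1 t.1.1.2 t.1.2 t.2.

Lemma quat_tupleK : cancel quat_tuple tuple_quat.
Proof. by case. Qed.

HB.instance Definition _ := Choice.copy (quat R) (can_type quat_tupleK).

End quat_choice.

Section quat_algebra.
Variable R : realType.
Implicit Types (p q r : quat R) (c d : R).

Definition quat_zero : quat R := Quat 0 0 0 0.
Definition quat_one : quat R := Quat 1 0 0 0.
Definition quat_opp q := Quat (- qre q) (- qi q) (- qj q) (- qk q).
Definition quat_add p q :=
  Quat (qre p + qre q) (qi p + qi q) (qj p + qj q) (qk p + qk q).
Definition quat_mul p q :=
  Quat (qre p * qre q - qi p * qi q - qj p * qj q - qk p * qk q)
       (qre p * qi q + qi p * qre q + qj p * qk q - qk p * qj q)
       (qre p * qj q - qi p * qk q + qj p * qre q + qk p * qi q)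
       (qre p * qk q + qi p * qj q - qj p * qi q + qk p * qre q).
Definition quat_scale c q := Quat (c * qre q) (c * qi q) (c * qj q) (c * qk q).

Lemma quat_addA : associative quat_add.
Proof. by move=> p q r; congr Quat => /=; rewrite addrA. Qed.
Lemma quat_addC : commutative quat_add.
Proof. by move=> p q; congr Quat => /=; rewrite addrC. Qed.
Lemma quat_add0 : left_id quat_zero quat_add.
Proof. by case=> *; rewrite /quat_add /= !add0r. Qed.
Lemma quat_addN : left_inverse quat_zero quat_opp quat_add.
Proof. by case=> *; rewrite /quat_add /= !addNr. Qed.

HB.instance Definition _ :=
  GRing.isZmodule.Build (quat R) quat_addA quat_addC quat_add0 quat_addN.

Lemma quat_mulA : associative quat_mul.
Proof. by move=> p q r; congr Quat => /=; ring. Qed.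
Lemma quat_mul1l : left_id quat_one quat_mul.
Proof. by case=> *; congr Quat => /=; ring. Qed.
Lemma quat_mul1r : right_id quat_one quat_mul.
Proof. by case=> *; congr Quat => /=; ring. Qed.
Lemma quat_mulDl : left_distributive quat_mul quat_add.
Proof. by move=> p q r; congr Quat => /=; ring. Qed.
Lemma quat_mulDr : right_distributive quat_mul quat_add.
Proof. by move=> p q r; congr Quat => /=; ring. Qed.
Lemma quat_one_neq0 : quat_one != quat_zero.
Proof. by apply/eqP => -[/eqP]; rewrite oner_eq0. Qed.

HB.instance Definition _ := GRing.Zmodule_isNzRing.Build (quat R)
  quat_mulA quat_mul1l quat_mul1r quat_mulDl quat_mulDr quat_one_neq0.

Lemma quat_scaleA c d q :
  quat_scale c (quat_scale d q) = quat_scale (c * d) q.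
Proof. by congr Quat => /=; rewrite mulrA. Qed.
Lemma quat_scale1 : left_id 1 quat_scale.
Proof. by case=> *; rewrite /quat_scale /= !mul1r. Qed.
Lemma quat_scaleDr : right_distributive quat_scale +%R.
Proof. by move=> c p q; congr Quat => /=; rewrite mulrDr. Qed.
Lemma quat_scaleDl q : {morph quat_scale^~ q : c d / c + d >-> c + d}.
Proof. by move=> c d; congr Quat => /=; rewrite mulrDl. Qed.

HB.instance Definition _ := GRing.Zmodule_isLmodule.Build R (quat R)
  quat_scaleA quat_scale1 quat_scaleDr quat_scaleDl.

Lemma quat_scaleAl c p q : c *: (p * q) = (c *: p) * q.
Proof. by congr Quat => /=; ring. Qed.
HB.instance Definition _ :=
  GRing.Lmodule_isLalgebra.Build R (quat R) quat_scaleAl.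

Lemma quat_scaleAr c p q : c *: (p * q) = p * (c *: q).
Proof. by congr Quat => /=; ring. Qed.
HB.instance Definition _ := GRing.Lalgebra_isAlgebra.Build R (quat R) quat_scaleAr.

End quat_algebra.

(* Lebesgue measure on the plane, on the Borel sigma-algebra. *)
Notation leb2 R := (@lebesgue_measure R \x @lebesgue_measure R)%E.

Section quaternion_functions.
Variable R : realType.
Implicit Types (f g h : R * R -> quat R) (mu nu q : quat R).

(* The elements of L^1(R^2; H) are represented by Borel functions. *)
Definition qintegrable f : Prop :=
  [/\ (leb2 R).-integrable setT (fun x => (qre (f x))%:E),
      (leb2 R).-integrable setT (fun x => (qi (f x))%:E),
      (leb2 R).-integrable setT (fun x => (qj (f x))%:E) &
      (leb2 R).-integrable setT (fun x => (qk (f x))%:E)].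

Definition qintegral f : quat R :=
  Quat (\int[leb2 R]_x qre (f x)) (\int[leb2 R]_x qi (f x))
       (\int[leb2 R]_x qj (f x)) (\int[leb2 R]_x qk (f x)).

Definition lmulq q f : R * R -> quat R := fun x => q * f x.

(* f^(phi1, phi2), for phi1 and phi2 in {0, 1}. *)
Definition reflection (phi1 phi2 : nat) f : R * R -> quat R :=
  fun x => f ((-1) ^+ phi1 * x.1, (-1) ^+ phi2 * x.2).

Definition qexp mu (theta : R) : quat R := (cos theta)%:A + sin theta *: mu.

Definition qfourier mu nu f : R * R -> quat R := fun y =>
  (2 * pi)^-1 *:
    qintegral (fun x => qexp mu (- (x.1 * y.1)) * qexp nu (- (x.2 * y.2)) * f x).

Definition qconv f g : R * R -> quat R := fun x =>
  qintegral (fun y => f y * g (x.1 - y.1, x.2 - y.2)).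

Definition is_mustard mu nu f g h : Prop :=
  qintegrable h /\
  forall y, qfourier mu nu h y =
            (2 * pi) *: (qfourier mu nu f y * qfourier mu nu g y).

(* The inverse transform need not converge on a product of transforms, so the
   Mustard convolution is the integrable function with the prescribed transform.
   It is unique almost everywhere only, hence the choice of a representative. *)
Definition mustard mu nu f g : R * R -> quat R :=
  xget (cst 0) [set h | is_mustard mu nu f g h].

End quaternion_functions.

(* The levels make "- q **: f *_[mu, nu] g" read -((q f) *_[mu, nu] g). *)
Notation "f ^^( phi1 , phi2 )" := (reflection phi1%N phi2%N f)
  (at level 2, format "f ^^( phi1 , phi2 )") : ring_scope.
Notation "q **: f" := (lmulq q f)
  (at level 33, right associativity) : ring_scope.
Notation "f *_[ mu , nu ] g" := (mustard mu nu f g)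
  (at level 34, no associativity, mu at level 200, nu at level 200,
   format "f  *_[ mu ,  nu ]  g") : ring_scope.

(* Main.v *)
(** Both sides of the identity are integrable, so it suffices that their
    quaternion Fourier transforms agree, provided the transform is injective on
    L^1(R^2; H) up to null sets.

    Injectivity.  Flipping the signs of the frequencies separates the four
    products of a cosine or sine in each variable, so it is enough that a real
    d in L^1(R^2) vanishes a.e. as soon as it is orthogonal to all cos(a.x + c).
    This orthogonality survives multiplication of d by a cosine, hence by
    polynomials in cosines and by bounded pointwise limits of those.  The
    polynomials (1 - u^k)^(k 2^k) in u = (1 - cos)/2 tend to the indicator of
    cos > 0, and dilating those sets gives the indicators of half planes.  The
    sets whose indicators preserve the orthogonality form a sigma-algebra, so
    all Borel sets occur, among them {d > 0}, and the integral of |d| is 0.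

    Existence of Mustard convolutions.  Let T_pq denote the transform against
    t_p(x1 y1) t_q(x2 y2) with t in {cos, sin}.  Then F(f) F(g) is a sum of terms
    F(f) T_pq(h g), and each of these is the transform of a combination of
    classical convolutions with the part of h g of parity (p, q).

    Identity.  Each row of the stated sum isolates one T_pq(g); it remains to
    reduce words in mu and nu using nu mu = a - mu nu. *)

Require Import Defs.
From HB Require Import structures.
From mathcomp Require Import all_boot all_order all_algebra ring lra.
From mathcomp Require Import all_classical all_reals all_analysis measurable_realfun.

Set Implicit Arguments.
Unset Strict Implicit.
Unset Printing Implicit Defensive.
Import Order.TTheory GRing.Theory Num.Theory.
Import numFieldNormedType.Exports.
Local Open Scope classical_set_scope.
Local Open Scope ring_scope.

(** * Integrable real functions and bounded multipliers *)

Section real_integrable.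
Context d (T : measurableType d) (R : realType) (m : {measure set T -> \bar R}).
Implicit Types u v w : T -> R.

Definition rintegrable u := m.-integrable setT (EFin \o u).

Lemma rintegrable_meas u : rintegrable u -> measurable_fun setT u.
Proof. by move=> iu; apply/measurable_EFinP; exact: measurable_int iu. Qed.

Lemma rintegrableD u v : rintegrable u -> rintegrable v ->
  rintegrable (fun x => u x + v x).
Proof.
move=> iu iv; exact: (integrableD measurableT iu iv).
Qed.

Lemma rintegrableZ (k : R) u : rintegrable u -> rintegrable (fun x => k * u x).
Proof.
by move=> iu; exact: (integrableZl measurableT k iu).
Qed.

Lemma rintegrableN u : rintegrable u -> rintegrable (fun x => - u x).
Proof. by move=> iu; exact: integrableN iu. Qed.

Lemma rintegrable_bounded u w : measurable_fun setT w ->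
  (exists C, forall x, `|w x| <= C) -> rintegrable u ->
  rintegrable (fun x => w x * u x).
Proof.
move=> mw [C wC] iu.
have bw : [bounded w x | x in setT].
  exists C; split; first exact: num_real.
  by move=> M CM x _ /=; rewrite (le_trans (wC x))// ltW.
exact: (integrableMr measurableT mw bw iu).
Qed.

Lemma Rintegral_dominated (w_ : nat -> T -> R) w u C :
  (forall n, measurable_fun setT (w_ n)) -> (forall n x, `|w_ n x| <= C) ->
  (forall x, w_ ^~ x @ \oo --> w x) -> rintegrable u ->
  (\int[m]_x (w_ n x * u x)) @[n --> \oo] --> \int[m]_x (w x * u x).
Proof.
move=> mw wC cw iu.
have iCu : m.-integrable setT (fun x => (C * `|u x|)%:E).
  by apply: rintegrableZ; exact: integrable_norm.
have mwu n : measurable_fun setT (fun x => (w_ n x * u x)%:E).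
  by apply/measurable_EFinP/measurable_funM => //; exact: rintegrable_meas.
have mwu' : measurable_fun setT (fun x => (w x * u x)%:E).
  apply/measurable_EFinP/measurable_funM; last exact: rintegrable_meas.
  by apply: (measurable_fun_cvg (h := w_)) => // x _; exact: cw.
have cwu : {ae m, forall x, setT x ->
    (w_ n x * u x)%:E @[n --> \oo] --> (w x * u x)%:E}.
  apply: aeW => x _; apply: cvg_EFin; first exact: nearW.
  by apply: cvgMl; exact: cw.
have bwu : {ae m, forall x n, setT x ->
    (`|(w_ n x * u x)%:E| <= (C * `|u x|)%:E)%E}.
  by apply: aeW => x n _; rewrite lee_fin normrM ler_wpM2r.
have [i _ H] := dominated_convergence measurableT mwu mwu' cwu iCu bwu.
by apply: fine_cvg; rewrite fineK//; exact: integrable_fin_num.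
Qed.

Lemma rintegrable_lin4 (c1 c2 c3 c4 : R) (u1 u2 u3 u4 : T -> R) :
  rintegrable u1 -> rintegrable u2 -> rintegrable u3 -> rintegrable u4 ->
  rintegrable (fun x => c1 * u1 x + c2 * u2 x + c3 * u3 x + c4 * u4 x).
Proof. by move=> *; do !apply: rintegrableD; exact: rintegrableZ. Qed.

Lemma Rintegral_lin4 (c1 c2 c3 c4 : R) (u1 u2 u3 u4 : T -> R) :
  rintegrable u1 -> rintegrable u2 -> rintegrable u3 -> rintegrable u4 ->
  \int[m]_x (c1 * u1 x + c2 * u2 x + c3 * u3 x + c4 * u4 x) =
  c1 * \int[m]_x u1 x + c2 * \int[m]_x u2 x + c3 * \int[m]_x u3 x + c4 * \int[m]_x u4 x.
Proof.
move=> i1 i2 i3 i4.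
have Z c u : rintegrable u -> rintegrable (fun x => c * u x) by exact: rintegrableZ.
rewrite RintegralD//; [|by do !apply: rintegrableD; exact: Z|exact: Z].
rewrite RintegralD//; [|by do !apply: rintegrableD; exact: Z|exact: Z].
rewrite RintegralD//; [|exact: Z..].
by rewrite !RintegralZl.
Qed.

End real_integrable.

(** * Polynomials approximating a step function on the unit interval *)

Section heaviside_polynomials.
Variable R : realType.
Implicit Types u v x : R.

(** Bernoulli's inequality, by induction on m. *)
Lemma onem_expr_ge v m : 0 <= v <= 1 -> 1 - m%:R * v <= (1 - v) ^+ m.
Proof.
move=> /andP[v0 v1]; elim: m => [|m IH]; first by rewrite mul0r subr0.
rewrite exprS -natr1.
have m0 : 0 <= m%:R :> R by [].
have : (1 - v) * (1 - m%:R * v) <= (1 - v) * (1 - v) ^+ m.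
  by apply: ler_wpM2l => //; rewrite subr_ge0.
by apply: le_trans; nra.
Qed.

(** Induction from (1 - v)(1 + (m+1) v) = 1 + m v - (m+1) v^2 <= 1 + m v. *)
Lemma onem_expr_le v m : 0 <= v <= 1 -> (1 - v) ^+ m * (1 + m%:R * v) <= 1.
Proof.
move=> /andP[v0 v1]; elim: m => [|m IH]; first by rewrite mul0r addr0 mulr1.
rewrite exprSr -mulrA.
apply: le_trans IH; apply: ler_wpM2l; first by rewrite exprn_ge0// subr_ge0.
have m0 : 0 <= m%:R :> R by [].
by rewrite -natr1; nra.
Qed.

(** With y the square root of x, one factor y^k of x^k = y^k y^k absorbs k: [onem_expr_le] at v = 1
    - y bounds k y^k by 1/(1 - y), and the other factor tends to 0. *)
Lemma cvg_natrM_expr x : 0 <= x < 1 -> (k%:R * x ^+ k) @[k --> \oo] --> 0.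
Proof.
move=> /andP[x0 x1].
pose y := Num.sqrt x.
have y0 : 0 <= y by exact: sqrtr_ge0.
have y1 : y < 1 by rewrite -sqrtr1 ltr_sqrt.
have bnd k : k%:R * x ^+ k <= (1 - y)^-1 * y ^+ k.
  rewrite -[x]sqr_sqrtr// -/y -exprM mulnC exprM expr2 mulrA.
  apply: ler_wpM2r; first exact: exprn_ge0.
  rewrite -[leRHS]mul1r ler_pdivlMr ?subr_gt0//.
  have := @onem_expr_le (1 - y) k; rewrite subKr => H.
  have {}H := H ltac:(apply/andP; split; lra).
  have yk0 : 0 <= y ^+ k by exact: exprn_ge0.
  by nra.
apply: (@squeeze_cvgr _ _ _ _ (cst 0) (fun k => (1 - y)^-1 * y ^+ k)).
- by apply: nearW => k; rewrite bnd mulr_ge0// exprn_ge0.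
- exact: cvg_cst.
- rewrite -[X in _ --> X](mulr0 (1 - y)^-1); apply: cvgMr.
  by apply: cvg_expr; rewrite ger0_norm.
Qed.

(** The exponent makes (k 2^k) u^k equal to k (2u)^k, which tends to 0 for u < 1/2 and to infinity
    for u >= 1/2. The extra factor k settles the value at u = 1/2. *)
Definition heaviside_poly (k : nat) u := (1 - u ^+ k) ^+ (k * 2 ^ k).

Lemma heaviside_poly_bound k u : 0 <= u <= 1 -> `|heaviside_poly k u| <= 1.
Proof.
move=> /andP[u0 u1].
have uk0 : 0 <= u ^+ k by exact: exprn_ge0.
have uk1 : u ^+ k <= 1 by exact: exprn_ile1.
by rewrite ger0_norm ?exprn_ge0 ?exprn_ile1//; lra.
Qed.

(** Below 1/2, Bernoulli's inequality squeezes the values towards 1. From 1/2 on, 1 + k (2u)^k >= k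
    + 1, so [onem_expr_le] bounds them by 1/(k+1). *)
Lemma heaviside_poly_cvg u : 0 <= u <= 1 ->
  heaviside_poly k u @[k --> \oo] --> ((u < 2^-1)%R%:R : R).
Proof.
move=> /andP[u0 u1].
have uk01 k : 0 <= u ^+ k <= 1 by rewrite exprn_ge0// exprn_ile1.
have mE k : (k * 2 ^ k)%:R * u ^+ k = k%:R * (2 * u) ^+ k.
  by rewrite natrM natrX exprMn mulrA.
case: ltP => u2 /=.
- apply: (@squeeze_cvgr _ _ _ _ (fun k => 1 - k%:R * (2 * u) ^+ k) (cst 1)).
  + apply: nearW => k; rewrite -mE onem_expr_ge//=.
    by rewrite (le_trans (ler_norm _))// heaviside_poly_bound// u0.
  + rewrite -[X in _ --> X](subr0 1); apply: cvgB; first exact: cvg_cst.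
    by apply: cvg_natrM_expr; apply/andP; split; lra.
  + exact: cvg_cst.
- apply: (@squeeze_cvgr _ _ _ _ (cst 0) (fun k => k.+1%:R^-1)).
  + near=> k.
    have h0 : 0 <= heaviside_poly k u.
      by rewrite exprn_ge0// subr_ge0; case/andP: (uk01 k).
    rewrite h0 /=.
    have := onem_expr_le (k * 2 ^ k) (uk01 k).
    rewrite mE -/(heaviside_poly k u) => A.
    have B : k%:R <= k%:R * (2 * u) ^+ k by rewrite ler_peMr// exprn_ege1//; lra.
    by rewrite -[leRHS]mul1r ler_pdivlMr// -natr1; nra.
  + exact: cvg_cst.
  + exact: cvg_harmonic.
Unshelve. all: by end_near. Qed.

End heaviside_polynomials.

(** * Uniqueness for real functions orthogonal to all cosines *)

Section fourier_uniqueness.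
Variable R : realType.
Notation plane := (measurableTypeR R * measurableTypeR R)%type.
Notation mu := (leb2 R).
Implicit Types (d e w : plane -> R) (a b c : R) (A B : set plane).

Definition phase a b c (x : R * R) : R := a * x.1 + b * x.2 + c.

Let measurable_fst_R : measurable_fun setT (fst : plane -> R).
Proof. exact: measurable_fst. Qed.

Let measurable_snd_R : measurable_fun setT (snd : plane -> R).
Proof. exact: measurable_snd. Qed.

Lemma measurable_phase a b c : measurable_fun setT (phase a b c : plane -> R).
Proof.
apply: measurable_funD => //; apply: measurable_funD;
  apply: measurable_funM => //.
Qed.

Lemma measurable_cos_phase a b c :
  measurable_fun setT (fun x : plane => cos (phase a b c x)).
Proof.
apply: measurableT_comp; last exact: measurable_phase.
by apply: continuous_measurable_fun; exact: continuous_cos.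
Qed.

(** The constant c in the phase brings in the sines, so that products of test functions are again
    combinations of test functions. *)
Definition fourier_null d := rintegrable mu d /\
  forall a b c, \int[mu]_x (cos (phase a b c x) * d x) = 0.

Lemma rintegrable_cos_phase d a b c : rintegrable mu d ->
  rintegrable mu (fun x => cos (phase a b c x) * d x).
Proof.
apply: rintegrable_bounded; first exact: measurable_cos_phase.
by exists 1 => x; exact: cos_max.
Qed.

Lemma fourier_null_lin d e a b : fourier_null d -> fourier_null e ->
  fourier_null (fun x => a * d x + b * e x).
Proof.
move=> [id nd] [ie ne]; split.
  by apply: rintegrableD; exact: rintegrableZ.
move=> y1 y2 c.
have E : (fun x => cos (phase y1 y2 c x) * (a * d x + b * e x)) =
    (fun x => a * (cos (phase y1 y2 c x) * d x) +
              b * (cos (phase y1 y2 c x) * e x)).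
  by apply/funext => x; ring.
rewrite E RintegralD//; [|by apply: rintegrableZ; exact: rintegrable_cos_phase..].
rewrite !RintegralZl//; [|exact: rintegrable_cos_phase..].
by rewrite nd ne !mulr0 addr0.
Qed.

(** The product of two cosines is half the sum of the cosines of the sum and of the difference of
    their phases. *)
Lemma fourier_null_cos d a b c : fourier_null d ->
  fourier_null (fun x => cos (phase a b c x) * d x).
Proof.
move=> [id nd]; split; first exact: rintegrable_cos_phase.
move=> y1 y2 c'.
have E : (fun x => cos (phase y1 y2 c' x) * (cos (phase a b c x) * d x)) =
    (fun x => 2^-1 * (cos (phase (y1 + a) (y2 + b) (c' + c) x) * d x) +
              2^-1 * (cos (phase (y1 - a) (y2 - b) (c' - c) x) * d x)).
  apply/funext => x.
  have -> : phase (y1 + a) (y2 + b) (c' + c) x =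
      phase y1 y2 c' x + phase a b c x by rewrite /phase; ring.
  have -> : phase (y1 - a) (y2 - b) (c' - c) x =
      phase y1 y2 c' x - phase a b c x by rewrite /phase; ring.
  by rewrite cosD cosB; field.
rewrite E RintegralD//; [|by apply: rintegrableZ; exact: rintegrable_cos_phase..].
rewrite !RintegralZl//; [|exact: rintegrable_cos_phase..].
by rewrite !nd !mulr0 addr0.
Qed.

(** Dominated convergence with the weights cos(phase) w_n, which C still bounds; the limit w
    inherits both measurability and the bound. *)
Lemma fourier_null_lim (w_ : nat -> plane -> R) w d C :
  (forall n, measurable_fun setT (w_ n)) -> (forall n x, `|w_ n x| <= C) ->
  (forall x, w_ ^~ x @ \oo --> w x) ->
  rintegrable mu d -> (forall n, fourier_null (fun x => w_ n x * d x)) ->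
  fourier_null (fun x => w x * d x).
Proof.
move=> mw wC cw id nw.
have wC' x : `|w x| <= C.
  have nx : `|w_ n x| @[n --> \oo] --> `|w x| by apply: cvg_norm; exact: cw.
  rewrite -(cvg_lim _ nx)//; apply: limr_le; first exact: cvgP nx.
  exact: nearW.
have mw' : measurable_fun setT w.
  by apply: (measurable_fun_cvg (h := w_)) => // x _; exact: cw.
split; first by apply: rintegrable_bounded => //; exists C.
move=> a b c.
have E v : (fun x => cos (phase a b c x) * (v x * d x)) =
    (fun x => (cos (phase a b c x) * v x) * d x).
  by apply/funext => x; rewrite mulrA.
have : (\int[mu]_x ((cos (phase a b c x) * w_ n x) * d x)) @[n --> \oo] -->
       \int[mu]_x ((cos (phase a b c x) * w x) * d x).
  apply: (@Rintegral_dominated _ _ _ _ _ _ _ C) => //.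
  - by move=> n; apply: measurable_funM => //; exact: measurable_cos_phase.
  - by move=> n x; rewrite normrM -[leRHS]mul1r ler_pM// cos_max.
  - by move=> x; apply: cvgMr; exact: cw.
under eq_cvg do rewrite -E (nw _).2.
by rewrite -E => /cvg_lim <-//; rewrite lim_cst.
Qed.

Lemma fourier_null_iter w : measurable_fun setT w -> (exists C, forall x, `|w x| <= C) ->
  (forall d, fourier_null d -> fourier_null (fun x => w x * d x)) ->
  forall n d, fourier_null d -> fourier_null (fun x => w x ^+ n * d x).
Proof.
move=> mw wC H; elim=> [|n IH] d nd.
  by under eq_fun do rewrite expr0 mul1r.
under eq_fun do rewrite exprSr -mulrA.
by apply: IH; exact: H.
Qed.

(** Quantifying over all d, rather than fixing one, lets the property be iterated, which gives
    closure under intersections. *)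
Definition localising A := measurable A /\
  forall d, fourier_null d -> fourier_null (fun x => \1_A x * d x).

(** With u = (1 - cos)/2 the set is {u < 1/2}, whose indicator is the bounded limit of
    [heaviside_poly k u]. Each of these is a power of 1 - u^k, and multiplication by 1 - u^k
    preserves [fourier_null]. *)
Lemma localising_cos_gt0 a b c : localising [set x | 0 < cos (phase a b c x)].
Proof.
pose u (x : plane) : R := 2^-1 * (1 - cos (phase a b c x)).
have u01 x : 0 <= u x <= 1.
  have := cos_geN1 (phase a b c x); have := cos_le1 (phase a b c x).
  by rewrite /u => A B; apply/andP; split; lra.
have mu_ : measurable_fun setT u.
  apply: measurable_funM => //; apply: measurable_funB => //.
  exact: measurable_cos_phase.
have nu d : fourier_null d -> fourier_null (fun x => u x * d x).
  move=> nd; have := fourier_null_lin (2^-1) (- 2^-1) nd (fourier_null_cos a b c nd).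
  by congr fourier_null; apply/funext => x; rewrite /u; ring.
have nuk k d : fourier_null d -> fourier_null (fun x => (1 - u x ^+ k) * d x).
  move=> nd; have nk : fourier_null (fun x => u x ^+ k * d x).
    by apply: fourier_null_iter => //; exists 1 => x; case/andP: (u01 x) => *; rewrite ger0_norm.
  have := fourier_null_lin 1 (-1) nd nk.
  by congr fourier_null; apply/funext => x; ring.
have muk k : measurable_fun setT (fun x => heaviside_poly k (u x)).
  apply: measurable_funX; apply: measurable_funB => //.
  exact: measurable_funX.
have indE : \1_[set x | 0 < cos (phase a b c x)] = (fun x => (u x < 2^-1)%R%:R) :> (_ -> R).
  apply/funext => x; rewrite indicE; congr (_%:R); congr nat_of_bool.
  apply/idP/idP; rewrite inE/= /u => H; lra.
split.
  rewrite -[X in measurable X]setTI.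
  have -> : [set x | 0 < cos (phase a b c x)] =
      (fun x => cos (phase a b c x)) @^-1` `]0, +oo[.
    by apply/seteqP; split => x /=; rewrite in_itv/= andbT.
  exact: measurable_cos_phase.
move=> d nd; rewrite indE.
apply: (@fourier_null_lim (fun k x => heaviside_poly k (u x)) _ _ 1) => //.
- by move=> n x; exact: heaviside_poly_bound.
- by move=> x; exact: heaviside_poly_cvg.
- by case: nd.
- move=> k; apply: (@fourier_null_iter (fun x => 1 - u x ^+ k)) => //.
  + by apply: measurable_funB => //; exact: measurable_funX.
  + exists 1 => x; case/andP: (u01 x) => u0 u1.
    have := exprn_ge0 k u0; have := exprn_ile1 k u0 u1 => *.
    by rewrite ger0_norm; lra.
  + exact: nuk.
Qed.

Lemma localising_lim (A_ : nat -> set plane) A :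
  (forall n, localising (A_ n)) -> (forall x, \1_(A_ n) x @[n --> \oo] --> (\1_A x : R)) ->
  measurable A -> localising A.
Proof.
move=> lA cA mA; split => // d nd.
apply: (@fourier_null_lim (fun n => \1_(A_ n)) _ _ 1) => //.
- by move=> n; apply: measurable_indic; case: (lA n).
- by move=> n x; rewrite indicE; case: (_ \in _); rewrite ?normr0 ?normr1.
- by case: nd.
- by move=> n; case: (lA n) => _; exact.
Qed.

(** For t = c - (a x1 + b x2), the sets B n are given by sin(t/(n+1)) > 0. Once |t|/(n+1) < pi this
    says t > 0, so the indicators are eventually constant at each point. *)
Lemma localising_half_plane a b c : localising [set x | phase a b 0 x < c].
Proof.
pose B n := [set x | 0 < cos (phase (a / n.+1%:R) (b / n.+1%:R) (pi / 2 - c / n.+1%:R) x)].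
apply: (@localising_lim B) => [n||]; first exact: localising_cos_gt0.
  move=> x; apply: cvg_near_cst.
  pose t := c - phase a b 0 x.
  have tE n : cos (phase (a / n.+1%:R) (b / n.+1%:R) (pi / 2 - c / n.+1%:R) x) =
      sin (t / n.+1%:R).
    rewrite -cosBpihalf -cosN; congr cos; rewrite /t /phase.
    by have : n.+1%:R != 0 :> R by []; move=> ?; field.
  near=> n; rewrite /= !indicE; congr (_%:R); congr nat_of_bool.
  have tn : `|t| / n.+1%:R < pi.
    rewrite ltr_pdivrMr// -ltr_pdivrMl ?pi_gt0//.
    apply: (@lt_trans _ _ n%:R); last by rewrite ltr_nat.
    by near: n; exact: nbhs_infty_gtr.
  apply/idP/idP; rewrite !inE /B /= tE => H.
  - rewrite -subr_gt0 -/t ltNge; apply/negP => t0.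
    move: H; rewrite ltNge => /negP; apply; rewrite -[t]opprK mulNr sinN oppr_le0.
    have [->|tn0] := eqVneq t 0; first by rewrite oppr0 mul0r sin0.
    apply/ltW/sin_gt0_pi; rewrite -ler0_norm// tn andbT divr_gt0//.
    by rewrite normr_gt0.
  - have t0 : 0 < t by rewrite subr_gt0.
    by apply: sin_gt0_pi; rewrite -(gtr0_norm t0) tn andbT divr_gt0 ?normr_gt0 ?gt_eqF.
rewrite -[X in measurable X]setTI.
have -> : [set x | phase a b 0 x < c] = phase a b 0 @^-1` `]-oo, c[.
  by apply/seteqP; split => x /=; rewrite in_itv.
exact: measurable_phase.
Unshelve. all: by end_near. Qed.

Lemma localising0 : localising set0.
Proof.
split => // d nd; have := fourier_null_lin 0 0 nd nd.
by congr fourier_null; apply/funext => x; rewrite indic0/=; ring.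
Qed.

Lemma localisingC A : localising A -> localising (~` A).
Proof.
move=> [mA lA]; split; first exact: measurableC.
move=> d nd; have := fourier_null_lin 1 (-1) nd (lA _ nd).
congr fourier_null; apply/funext => x; rewrite !indicE in_setC.
by case: (x \in A) => /=; ring.
Qed.

Lemma localisingI A B : localising A -> localising B -> localising (A `&` B).
Proof.
move=> [mA lA] [mB lB]; split; first exact: measurableI.
move=> d nd; have := lA _ (lB _ nd).
by congr fourier_null; apply/funext => x; rewrite indicI mulrA.
Qed.

Lemma localisingU A B : localising A -> localising B -> localising (A `|` B).
Proof.
move=> lA lB; rewrite -[_ `|` _]setCK setCU.
by apply: localisingC; apply: localisingI; exact: localisingC.
Qed.

(** A countable union is the limit of its finite partial unions, whose indicators are eventually
    constant at each point. *)
Lemma localising_sigma_algebra : sigma_algebra setT localising.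
Proof.
split; first exact: localising0.
  by move=> A; rewrite setTD; exact: localisingC.
move=> F lF.
apply: (@localising_lim (fun n => \big[setU/set0]_(i < n) F i)).
- move=> n; elim/big_ind: _ => //; [exact: localising0|exact: localisingU].
- move=> x; apply: cvg_near_cst.
  have [[i _ Fix]|nFx] := pselect ((\bigcup_i F i) x).
    exists i.+1 => // n /= iltn; rewrite !indicE (mem_set (_ : (\bigcup_i F i) x)); last by exists i.
    by rewrite mem_set// -bigcup_mkord; exists i.
  apply: nearW => n; rewrite !indicE !memNset//.
  by rewrite -bigcup_mkord => -[i /= _ Fix]; apply: nFx; exists i.
- by apply: bigcupT_measurable => n; case: (lF n).
Qed.

(** The sets B with localising preimage form a sigma-algebra, and the open left rays generate the
    Borel sets of the line. *)
Lemma localising_preimage (p : plane -> R) :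
  (forall c, localising (p @^-1` `]-oo, c[)) ->
  forall B : set (measurableTypeR R), measurable B -> localising (p @^-1` B).
Proof.
move=> lp B mB; have : (@ocitv R).-sigma.-measurable B by exact: mB.
rewrite RGenInftyO.measurableE.
suff sub : <<s @RGenInftyO.G R>> `<=` [set B | localising (p @^-1` B)] by exact: sub.
apply: smallest_sub.
  have [_ lC lU] := localising_sigma_algebra; split => /=.
  - by rewrite preimage_set0; exact: localising0.
  - by move=> A lA; rewrite setTD preimage_setC; exact: localisingC.
  - by move=> F lF; rewrite preimage_bigcup; exact: lU.
by move=> _ [c ->]; exact: lp.
Qed.

(** The product sigma-algebra is generated by preimages under the two projections, so half planes
    bounded by a vertical or a horizontal line suffice. *)
Lemma measurable_localising A : measurable A -> localising A.
Proof.
apply: smallest_sub; first exact: localising_sigma_algebra.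
rewrite subUset; split => _ [B mB <-]; rewrite setTI.
- apply: localising_preimage => // c.
  have := localising_half_plane 1 0 c; congr localising.
  by apply/seteqP; split => x /=; rewrite in_itv/= /phase mul1r mul0r !addr0.
- apply: localising_preimage => // c.
  have := localising_half_plane 0 1 c; congr localising.
  by apply/seteqP; split => x /=; rewrite in_itv/= /phase mul1r mul0r add0r addr0.
Qed.

Theorem fourier_null_ae d : fourier_null d -> {ae mu, forall x, d x = 0}.
Proof.
move=> nd; have [id _] := nd.
have md : measurable_fun setT d by exact: rintegrable_meas id.
have lP : localising [set x | 0 < d x].
  apply: measurable_localising; rewrite -[X in measurable X]setTI.
  have -> : [set x | 0 < d x] = d @^-1` `]0, +oo[.
    by apply/seteqP; split => x /=; rewrite in_itv/= andbT.
  exact: md.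
have nP := lP.2 _ nd; have nN := (localisingC lP).2 _ nd.
(* Subtracting the part of d on the complement of {d > 0} from the part on {d > 0} gives |d|, and
   the zero phase turns the cosine into 1. *)
have [_ /(_ 0 0 0)] := fourier_null_lin 1 (-1) nP nN.
have -> : (fun x => cos (phase 0 0 0 x) * (1 * (\1_[set x | 0 < d x] x * d x) +
    -1 * (\1_(~` [set x | 0 < d x]) x * d x))) = (fun x => `|d x|).
  apply/funext => x; rewrite /phase !mul0r !addr0 cos0 mul1r !indicE in_setC.
  have [d0|d0] := ltP 0 (d x).
    by rewrite mem_set//= gtr0_norm//; ring.
  by rewrite memNset/= ?ler0_norm//; [ring|rewrite ltNge d0].
move=> n0.
have a0 : (\int[mu]_x `|(d x)%:E| = 0)%E.
  have fn := integrable_fin_num measurableT (integrable_norm id).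
  by rewrite -(fineK fn); congr EFin.
have mEd : measurable_fun setT (EFin \o d) by exact/measurable_EFinP.
have /(ae_eq_integral_abs mu measurableT mEd) := a0.
by apply: filterS => x /= /(_ I) [].
Qed.

End fourier_uniqueness.

(** * Invariance of Lebesgue measure under reflections and translations *)

Section affine_invariance.
Variable R : realType.
Notation line := (measurableTypeR R).
Notation plane := (line * line)%type.
Notation leb := (@lebesgue_measure R).
Notation mu := (leb2 R).
Implicit Types (s b : R) (u : plane -> R).

Definition sign s := s = 1 \/ s = -1.

Definition affine s b : line -> line := fun t => s * t + b.

Lemma measurable_affine s b : measurable_fun setT (affine s b).
Proof.
have : measurable_fun setT (fun t : R => s * t + b).
  by apply: measurable_funD => //; exact: measurable_funM.
exact.
Qed.

(** By uniqueness of Lebesgue measure, half-open intervals suffice. For s = -1 the preimage is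
    closed at the other end, which does not change its length. *)
Lemma lebesgue_measure_affine s b (A : set line) : sign s -> measurable A ->
  leb (affine s b @^-1` A) = leb A.
Proof.
move=> s1 mA.
have H : pushforward leb (affine s b) A = leb A.
  apply/esym/lebesgue_measure_unique => //=; first exact: measurable_affine.
  move=> ms _ [[x y]] _ <- /=; rewrite /pushforward.
  have [->|->] := s1.
    have -> : affine 1 b @^-1` `]x, y] = `]x - b, y - b]%classic :> set R.
      by apply/seteqP; split => t; rewrite /= /affine !in_itv/= => /andP[? ?]; apply/andP; split; lra.
    rewrite !lebesgue_measure_itv/= !lte_fin ltrD2r.
    by case: ifP => // _; rewrite -!EFinB; congr EFin; ring.
  have -> : affine (-1) b @^-1` `]x, y] = `[b - y, b - x[%classic :> set R.
    by apply/seteqP; split => t; rewrite /= /affine !in_itv/= => /andP[? ?]; apply/andP; split; lra.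
  rewrite !lebesgue_measure_itv/= !lte_fin ltrD2l ltrN2.
  by case: ifP => // _; rewrite -!EFinB; congr EFin; ring.
exact: H.
Qed.

Definition affine2 s1 s2 (c : plane) : plane -> plane :=
  fun x => (affine s1 c.1 x.1, affine s2 c.2 x.2).

Lemma measurable_affine2 s1 s2 c : measurable_fun setT (affine2 s1 s2 c).
Proof.
by apply/measurable_fun_pair; apply: measurableT_comp => //; exact: measurable_affine.
Qed.

(** The map acts on each coordinate separately, so uniqueness of the product measure reduces the
    claim to rectangles. *)
Lemma leb2_affine2 s1 s2 c (A : set plane) : sign s1 -> sign s2 -> measurable A ->
  mu A = pushforward mu (affine2 s1 s2 c) A.
Proof.
move=> h1 h2 mA; apply: product_measure_unique => //; first exact: measurable_affine2.
move=> ? B C mB mC.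
rewrite -[LHS]/(mu ((affine s1 c.1 @^-1` B) `*` (affine s2 c.2 @^-1` C))).
rewrite product_measure1E//.
- by congr (_ * _)%E; exact: lebesgue_measure_affine.
- by rewrite -[X in measurable X]setTI; exact: measurable_affine.
- by rewrite -[X in measurable X]setTI; exact: measurable_affine.
Qed.

Lemma ge0_integral_affine2 s1 s2 c (f : plane -> \bar R) : sign s1 -> sign s2 ->
  measurable_fun setT f -> (forall x, 0 <= f x)%E ->
  (\int[mu]_x f (affine2 s1 s2 c x) = \int[mu]_x f x)%E.
Proof.
move=> h1 h2 mf f0.
have E := ge0_integral_pushforward (measurable_affine2 s1 s2 c) mu measurableT mf
  (fun x _ => f0 x).
rewrite preimage_setT in E; apply: esym; apply: etrans E.
apply: eq_measure_integral => [|? A mA _]; first exact: measurable_affine2.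
exact: leb2_affine2.
Qed.

Lemma rintegrable_affine2 s1 s2 c u : sign s1 -> sign s2 -> rintegrable mu u ->
  rintegrable mu (fun x => u (affine2 s1 s2 c x)).
Proof.
move=> h1 h2 /integrableP[mu_ iu]; apply/integrableP; split.
  by apply: (measurableT_comp mu_); exact: measurable_affine2.
rewrite (@ge0_integral_affine2 s1 s2 c (fun x => `|(u x)%:E|%E))//.
exact: measurableT_comp.
Qed.

Lemma Rintegral_affine2 s1 s2 c u : sign s1 -> sign s2 -> rintegrable mu u ->
  \int[mu]_x u (affine2 s1 s2 c x) = \int[mu]_x u x.
Proof.
move=> h1 h2 iu; congr fine.
have mEu : measurable_fun setT (EFin \o u).
  by apply/measurable_EFinP; exact: rintegrable_meas iu.
have E := integral_pushforward (measurable_affine2 s1 s2 c) (mu := mu) (D := setT) mEu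
  (rintegrable_affine2 c h1 h2 iu) measurableT.
rewrite preimage_setT in E; apply: esym; apply: etrans E.
apply: eq_measure_integral => [|? A mA _]; first exact: measurable_affine2.
exact: leb2_affine2.
Qed.

End affine_invariance.

(** * Convolution kernels and Fubini's theorem *)

Section convolution_kernel.
Variable R : realType.
Notation plane := (measurableTypeR R * measurableTypeR R)%type.
Notation mu := (leb2 R).

(* A fresh constant, because the sigma-finite structure inferred on a product
   measure is the one for finite factors, which does not apply here. *)
Definition planar : set plane -> \bar R := mu.
HB.instance Definition _ := Measure.copy planar mu.

Let planar_sigma_finite : sigma_finite setT planar.
Proof.
by have [] := lebesgue_integral_fubini.measure_function_Measure_isSigmaFinite__to__measure_function_isSigmaFinite
  (@lebesgue_measure R) (@lebesgue_measure R).
Qed.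

HB.instance Definition _ :=
  Measure_isSigmaFinite.Build _ _ _ planar planar_sigma_finite.

Notation mumu := (planar \x planar)%E.
Implicit Types (u v w : plane -> R) (K : plane * plane -> R).

(** The real-valued integral is 0 where the extended one is infinite, so it is dominated everywhere
    by the partial integral of Fubini's theorem. *)
Lemma rintegrable_partial K : rintegrable mumu K ->
  rintegrable mu (fun x => \int[mu]_y K (x, y)).
Proof.
move=> iK; have iF := integrable_fubini_F iK.
apply: (le_integrable measurableT _ _ iF).
  apply/measurable_EFinP; apply: measurableT_comp => //.
  exact: measurable_int iF.
move=> x _; rewrite /Rintegral /fubini_F /=.
by case: (\int[mu]_y (K (x, y))%:E)%E => [r| |] //=; rewrite ?normr0 ?leey.
Qed.

Lemma bounded_fst w K : measurable_fun setT w -> (exists C, forall x, `|w x| <= C) ->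
  rintegrable mumu K -> rintegrable mumu (fun z => w z.1 * K z).
Proof.
move=> mw [C wC]; apply: rintegrable_bounded; last by exists C.
by apply: measurableT_comp => //; exact: measurable_fst.
Qed.

Lemma Rintegral_partial w K : measurable_fun setT w -> (exists C, forall x, `|w x| <= C) ->
  rintegrable mumu K ->
  \int[mu]_x (w x * \int[mu]_y K (x, y)) = \int[mumu]_z (w z.1 * K z).
Proof.
move=> mw wC iK.
have iwK : rintegrable mumu (fun z => w z.1 * K z) by exact: bounded_fst.
rewrite {3}/Rintegral -(integral12_prod_meas1 iwK); congr fine.
(* The two integrands need to agree almost everywhere only, namely where the section of K at x is
   integrable. *)
apply: ae_eq_integral => //.
- apply/measurable_EFinP; apply: measurable_funM => //.
  exact: rintegrable_meas (rintegrable_partial iK).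
- exact: measurable_fubini_F iwK.
apply: filterS (ae_integrable1 iK) => x iKx _ /=.
rewrite /fubini_F /= -RintegralZl// /Rintegral fineK//.
by apply: integrable_fin_num => //; exact: rintegrableZ.
Qed.

(** In z = (x, y), x is the point of evaluation of the convolution and y the variable of
    integration. *)
Definition conv_kernel u v (z : plane * plane) : R :=
  u z.2 * v (z.1.1 - z.2.1, z.1.2 - z.2.2).

Lemma measurable_translate :
  measurable_fun setT (fun z : plane * plane => (z.1.1 - z.2.1, z.1.2 - z.2.2) : plane).
Proof.
have m1 : measurable_fun setT (fun z : plane * plane => z.1.1 : R).
  apply: (measurableT_comp (measurable_fst : measurable_fun _ (fst : plane -> R))).
  exact: measurable_fst.
have m2 : measurable_fun setT (fun z : plane * plane => z.1.2 : R).
  apply: (measurableT_comp (measurable_snd : measurable_fun _ (snd : plane -> R))).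
  exact: measurable_fst.
have m3 : measurable_fun setT (fun z : plane * plane => z.2.1 : R).
  apply: (measurableT_comp (measurable_fst : measurable_fun _ (fst : plane -> R))).
  exact: measurable_snd.
have m4 : measurable_fun setT (fun z : plane * plane => z.2.2 : R).
  apply: (measurableT_comp (measurable_snd : measurable_fun _ (snd : plane -> R))).
  exact: measurable_snd.
apply/measurable_fun_pair.
  exact: (measurable_funB m1 m3).
exact: (measurable_funB m2 m4).
Qed.

Lemma measurable_conv_kernel u v : measurable_fun setT u -> measurable_fun setT v ->
  measurable_fun setT (conv_kernel u v).
Proof.
move=> mu_ mv; apply: measurable_funM.
  by apply: measurableT_comp => //; exact: measurable_snd.
by apply: (measurableT_comp mv); exact: measurable_translate.
Qed.

Lemma translateE (x y : plane) :
  (x.1 - y.1, x.2 - y.2) = affine2 1 1 (- y.1, - y.2) x :> plane.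
Proof. by rewrite /affine2 /affine !mul1r. Qed.

(** Tonelli's theorem: integrating |u(y) v(x - y)| over x first gives |u(y)| times the norm of v, by
    translation invariance, and then the product of the norms. *)
Lemma rintegrable_conv_kernel u v : rintegrable mu u -> rintegrable mu v ->
  rintegrable mumu (conv_kernel u v).
Proof.
move=> iu iv; have mu_ := rintegrable_meas iu; have mv := rintegrable_meas iv.
have mEv : measurable_fun setT (fun x => `|(v x)%:E|%E).
  by apply: measurableT_comp => //; exact/measurable_EFinP.
have mK := measurable_conv_kernel mu_ mv.
apply/integrable21ltyP; first exact/measurable_EFinP.
have E y : (\int[mu]_x `|(conv_kernel u v (x, y))%:E| =
    `|(u y)%:E| * \int[mu]_x `|(v x)%:E|)%E.
  rewrite /conv_kernel /=.
  under eq_integral do rewrite normrM EFinM translateE.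
  rewrite (@ge0_integralZl _ _ _ _ _ _ (fun x => `|(v (affine2 1 1 (- y.1, - y.2) x))%:E|%E))//; last first.
    by apply: (measurableT_comp mEv); exact: measurable_affine2.
  by congr (_ * _)%E; apply: (@ge0_integral_affine2 _ _ _ _ (fun x => `|(v x)%:E|%E)) => //; left.
under eq_integral do rewrite E.
have /integrableP[_ fu] := iu; have /integrableP[_ fv] := iv.
rewrite ge0_integralZr//; first last.
- exact: integral_ge0.
- by apply: measurableT_comp => //; exact/measurable_EFinP.
apply: lte_mul_pinfty => //; first exact: integral_ge0.
by rewrite ge0_fin_numE//; exact: integral_ge0.
Qed.

(** Integrating over x first and substituting x + y for x moves the shift from v to the weight w,
    where addition formulas can be applied. *)
Lemma Rintegral_conv_kernel w u v : measurable_fun setT w ->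
  (exists C, forall x, `|w x| <= C) -> rintegrable mu u -> rintegrable mu v ->
  \int[mumu]_z (w z.1 * conv_kernel u v z) =
  \int[mu]_y (u y * \int[mu]_x (w (x.1 + y.1, x.2 + y.2) * v x)).
Proof.
move=> mw wC iu iv.
have iwK : rintegrable mumu (fun z => w z.1 * conv_kernel u v z).
  by apply: bounded_fst => //; exact: rintegrable_conv_kernel.
have wEv y : (fun x : plane => w (x.1 + y.1, x.2 + y.2) * v x) =
    (fun x => w (affine2 1 1 y x) * v x).
  by apply/funext => x; rewrite /affine2 /affine !mul1r.
have iwv y : rintegrable mu (fun x : plane => w (x.1 + y.1, x.2 + y.2) * v x).
  rewrite wEv; apply: rintegrable_bounded => //.
    by apply: (measurableT_comp mw); exact: measurable_affine2.
  by case: wC => C wC; exists C.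
rewrite {1}/Rintegral -(integral21_prod_meas1 iwK); congr fine.
apply: eq_integral => y _; rewrite /fubini_G /=.
have /= I := @Rintegral_affine2 R 1 1 (- y.1, - y.2) _ (or_introl erefl) (or_introl erefl) (iwv y).
have iI := @rintegrable_affine2 R 1 1 (- y.1, - y.2) _ (or_introl erefl) (or_introl erefl) (iwv y).
rewrite -I -RintegralZl// /Rintegral fineK.
  apply: eq_integral => x _; rewrite /conv_kernel /= translateE /affine2 /affine !mul1r /=.
  by rewrite !subrK -surjective_pairing; congr EFin; ring.
by apply: integrable_fin_num => //; exact: rintegrableZ.
Qed.

End convolution_kernel.

(** * Quaternion integrals and transforms against products of sines and cosines *)

Section quaternion_transforms.
Variable R : realType.
Notation plane := (measurableTypeR R * measurableTypeR R)%type.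
Notation mu := (leb2 R).
Implicit Types (f g : plane -> quat R) (h : quat R) (y : R * R) (p q : bool).

Lemma qintegrable_comp f : qintegrable f ->
  [/\ rintegrable mu (fun x => qre (f x)), rintegrable mu (fun x => qi (f x)),
      rintegrable mu (fun x => qj (f x)) & rintegrable mu (fun x => qk (f x))].
Proof. by []. Qed.

Lemma qintegrableD f g : qintegrable f -> qintegrable g -> qintegrable (f + g).
Proof. by move=> [? ? ? ?] [? ? ? ?]; split; exact: rintegrableD. Qed.

Lemma qintegrableN f : qintegrable f -> qintegrable (- f).
Proof. by move=> [? ? ? ?]; split; exact: rintegrableN. Qed.

Lemma qintegrableZ (c : R) f : qintegrable f -> qintegrable (c *: f).
Proof. by move=> [? ? ? ?]; split; exact: rintegrableZ. Qed.

(** Signs are put into the coefficients to fit [rintegrable_lin4] and [Rintegral_lin4]. *)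
Lemma lmulq_comp h f :
  [/\ (fun x => qre (lmulq h f x)) = (fun x =>
         qre h * qre (f x) + - qi h * qi (f x) + - qj h * qj (f x) + - qk h * qk (f x)),
      (fun x => qi (lmulq h f x)) = (fun x =>
         qre h * qi (f x) + qi h * qre (f x) + qj h * qk (f x) + - qk h * qj (f x)),
      (fun x => qj (lmulq h f x)) = (fun x =>
         qre h * qj (f x) + - qi h * qk (f x) + qj h * qre (f x) + qk h * qi (f x)) &
      (fun x => qk (lmulq h f x)) = (fun x =>
         qre h * qk (f x) + qi h * qj (f x) + - qj h * qi (f x) + qk h * qre (f x))].
Proof. by split; apply/funext => x /=; ring. Qed.

Lemma qintegrable_lmulq h f : qintegrable f -> qintegrable (lmulq h f).
Proof.
have [E0 E1 E2 E3] := lmulq_comp h f.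
move=> [i0 i1 i2 i3]; split.
- by rewrite -/(rintegrable _ _) -[X in rintegrable _ X]/(fun x => qre (lmulq h f x)) E0; exact: rintegrable_lin4.
- by rewrite -/(rintegrable _ _) -[X in rintegrable _ X]/(fun x => qi (lmulq h f x)) E1; exact: rintegrable_lin4.
- by rewrite -/(rintegrable _ _) -[X in rintegrable _ X]/(fun x => qj (lmulq h f x)) E2; exact: rintegrable_lin4.
- by rewrite -/(rintegrable _ _) -[X in rintegrable _ X]/(fun x => qk (lmulq h f x)) E3; exact: rintegrable_lin4.
Qed.

Lemma qintegrable_bounded (w : plane -> R) f : measurable_fun setT w ->
  (exists C, forall x, `|w x| <= C) -> qintegrable f ->
  qintegrable (fun x => w x *: f x).
Proof. by move=> mw bw [? ? ? ?]; split; exact: rintegrable_bounded. Qed.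

Lemma qintegralD f g : qintegrable f -> qintegrable g ->
  qintegral (f + g) = qintegral f + qintegral g.
Proof. by move=> [? ? ? ?] [? ? ? ?]; congr Quat; exact: RintegralD. Qed.

Lemma qintegralZ (c : R) f : qintegrable f -> qintegral (c *: f) = c *: qintegral f.
Proof. by move=> [? ? ? ?]; congr Quat; exact: RintegralZl. Qed.

Lemma quatP (a b : quat R) : qre a = qre b -> qi a = qi b -> qj a = qj b ->
  qk a = qk b -> a = b.
Proof. by case: a b => [? ? ? ?] [? ? ? ?] /= -> -> -> ->. Qed.

Lemma qintegral_lmulq h f : qintegrable f ->
  qintegral (lmulq h f) = h * qintegral f.
Proof.
have [E0 E1 E2 E3] := lmulq_comp h f.
move=> /qintegrable_comp[i0 i1 i2 i3]; apply: quatP.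
- by rewrite [LHS]/qre/= E0 Rintegral_lin4//=; ring.
- by rewrite [LHS]/qi/= E1 Rintegral_lin4//=; ring.
- by rewrite [LHS]/qj/= E2 Rintegral_lin4//=; ring.
- by rewrite [LHS]/qk/= E3 Rintegral_lin4//=; ring.
Qed.

(** The boolean is the parity of the function: [true] for the odd one. *)
Definition trig p (t : R) := if p then sin t else cos t.

Definition trig_kernel p q y (x : plane) : R := trig p (x.1 * y.1) * trig q (x.2 * y.2).

Lemma trigD p (s t : R) :
  trig p (s + t) = trig p s * cos t + (-1) ^+ (~~ p) * (trig (~~ p) s * sin t).
Proof. by case: p; rewrite /= ?sinD ?cosD ?expr0 ?expr1; ring. Qed.

Lemma trig_signM p a (t : R) : trig p ((-1) ^+ a * t) = (-1) ^+ (p * a) * trig p t.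
Proof.
rewrite -signr_odd -[in RHS]signr_odd oddM; case: p; case: (odd a) => /=;
  by rewrite ?expr1 ?expr0 ?mulN1r ?mul1r ?sinN ?cosN.
Qed.

Lemma trig_bound p (t : R) : `|trig p t| <= 1.
Proof. by case: p => /=; [exact: sin_max|exact: cos_max]. Qed.

Lemma measurable_trig_kernel p q y : measurable_fun setT (trig_kernel p q y).
Proof.
have mt (r : bool) : measurable_fun setT (trig r : R -> R).
  by case: r; apply: continuous_measurable_fun; [exact: continuous_sin|exact: continuous_cos].
have mf : measurable_fun setT (fst : plane -> R) by exact: measurable_fst.
have ms : measurable_fun setT (snd : plane -> R) by exact: measurable_snd.
by apply: measurable_funM; apply: (measurableT_comp (mt _)); apply: measurable_funM.
Qed.

Lemma trig_kernel_bounded p q y : exists C, forall x, `|trig_kernel p q y x| <= C.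
Proof.
by exists 1 => x; rewrite normrM -[leRHS]mul1r ler_pM// trig_bound.
Qed.

Lemma trig_kernelD p q y (x z : plane) :
  trig_kernel p q y (x.1 + z.1, x.2 + z.2) =
    trig_kernel p q y z * trig_kernel false false y x
    + (-1) ^+ (~~ q) * (trig_kernel p (~~ q) y z * trig_kernel false true y x)
    + (-1) ^+ (~~ p) * (trig_kernel (~~ p) q y z * trig_kernel true false y x)
    + (-1) ^+ (~~ p) * ((-1) ^+ (~~ q) *
        (trig_kernel (~~ p) (~~ q) y z * trig_kernel true true y x)).
Proof.
have D (s t r : R) : (s + t) * r = t * r + s * r by rewrite mulrDl addrC.
rewrite /trig_kernel [fst (_, _)]/= [snd (_, _)]/= !D !trigD /=.
move: (trig p _) (trig q _) (trig (~~ p) _) (trig (~~ q) _) => A B A' B'.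
move: (cos _) (sin _) (cos _) (sin _) ((-1) ^+ _) ((-1) ^+ _) => c1 s1 c2 s2 e1 e2.
by ring.
Qed.

(** The transform T_pq of the overview. *)
Definition qtrig p q f y := qintegral (fun x => trig_kernel p q y x *: f x).

Let rtrig p q (u : plane -> R) y := \int[mu]_x (trig_kernel p q y x * u x).

Lemma qintegrable_trig p q y f : qintegrable f ->
  qintegrable (fun x => trig_kernel p q y x *: f x).
Proof.
exact: (qintegrable_bounded (measurable_trig_kernel p q y) (trig_kernel_bounded p q y)).
Qed.

Lemma qtrigD p q f g y : qintegrable f -> qintegrable g ->
  qtrig p q (f + g) y = qtrig p q f y + qtrig p q g y.
Proof.
move=> If Ig; rewrite -qintegralD; [|exact: qintegrable_trig..].
by congr qintegral; apply/funext => x; exact: scalerDr.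
Qed.

Lemma qtrigZ p q (c : R) f y : qintegrable f ->
  qtrig p q (c *: f) y = c *: qtrig p q f y.
Proof.
move=> If; rewrite -qintegralZ; last exact: qintegrable_trig.
congr qintegral; apply/funext => x; rewrite -[RHS]/(c *: (_ *: _)) !scalerA.
by rewrite mulrC.
Qed.

Lemma qtrigN p q f y : qintegrable f -> qtrig p q (- f) y = - qtrig p q f y.
Proof. by move=> If; rewrite -scaleN1r qtrigZ// scaleN1r. Qed.

Lemma qtrig_lmulq p q h f y : qintegrable f ->
  qtrig p q (lmulq h f) y = h * qtrig p q f y.
Proof.
move=> If; rewrite -qintegral_lmulq; last exact: qintegrable_trig.
by congr qintegral; apply/funext => x; rewrite /lmulq scalerAr.
Qed.

Lemma sign_expr a : sign ((-1) ^+ a : R).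
Proof. by rewrite -signr_odd; case: (odd a); [right|left]. Qed.

Lemma reflectionE a b f : reflection a b f =
  (fun x => f (affine2 ((-1) ^+ a) ((-1) ^+ b) 0 x)).
Proof. by apply/funext => x; rewrite /affine2 /affine !addr0. Qed.

Lemma qintegrable_reflection a b f : qintegrable f -> qintegrable (reflection a b f).
Proof.
rewrite reflectionE => -[i0 i1 i2 i3].
have sa := sign_expr a; have sb := sign_expr b; split.
- exact: (rintegrable_affine2 0 sa sb i0).
- exact: (rintegrable_affine2 0 sa sb i1).
- exact: (rintegrable_affine2 0 sa sb i2).
- exact: (rintegrable_affine2 0 sa sb i3).
Qed.

Lemma qintegral_reflection a b f : qintegrable f ->
  qintegral (reflection a b f) = qintegral f.
Proof.
rewrite reflectionE => -[i0 i1 i2 i3].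
have sa := sign_expr a; have sb := sign_expr b; congr Quat.
- exact: (Rintegral_affine2 0 sa sb i0).
- exact: (Rintegral_affine2 0 sa sb i1).
- exact: (Rintegral_affine2 0 sa sb i2).
- exact: (Rintegral_affine2 0 sa sb i3).
Qed.

(** A change of variables moves the reflection onto the kernel, whose parities in the two variables
    are p and q. *)
Lemma qtrig_reflection p q a b f y : qintegrable f ->
  qtrig p q (reflection a b f) y = (-1) ^+ (p * a + q * b) *: qtrig p q f y.
Proof.
move=> If; rewrite -qintegralZ; last exact: qintegrable_trig.
rewrite -[RHS](qintegral_reflection a b); last first.
  by apply: qintegrableZ; exact: qintegrable_trig.
congr qintegral; apply/funext => x.
rewrite /reflection -[RHS]/(_ *: (trig_kernel _ _ _ _ *: f _)) scalerA; congr (_ *: _).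
rewrite /trig_kernel/= -!mulrA !trig_signM exprD.
have E n : (-1) ^+ n * (-1) ^+ n = 1 :> R by rewrite -expr2 sqrr_sign.
set s := (-1) ^+ (p * a); set t := (-1) ^+ (q * b).
transitivity ((s * s) * (t * t) * (trig p (x.1 * y.1) * trig q (x.2 * y.2))).
  by rewrite !E !mul1r.
by ring.
Qed.

End quaternion_transforms.

(** * Transforms of classical convolutions *)

Section quaternion_convolution.
Variable R : realType.
Notation plane := (measurableTypeR R * measurableTypeR R)%type.
Notation mu := (leb2 R).
Notation mumu := (@planar R \x @planar R)%E.
Implicit Types (f g : plane -> quat R) (y : R * R) (p q : bool).

Let rtrig p q y (u : plane -> R) := \int[mu]_x (trig_kernel p q y x * u x).

(** The value at y of the transform of parity (p, q) of the real convolution of u and v; the signs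
    are those of the addition formula of the cosine. *)
Let rconv p q y (u v : plane -> R) : R :=
  rtrig p q y u * rtrig false false y v
  + (-1) ^+ (~~ q) * (rtrig p (~~ q) y u * rtrig false true y v)
  + (-1) ^+ (~~ p) * (rtrig (~~ p) q y u * rtrig true false y v)
  + (-1) ^+ (~~ p) * ((-1) ^+ (~~ q) *
      (rtrig (~~ p) (~~ q) y u * rtrig true true y v)).

Let rintegrable_trig p q y u : rintegrable mu u ->
  rintegrable mu (fun x => trig_kernel p q y x * u x).
Proof.
exact: (rintegrable_bounded (measurable_trig_kernel p q y) (trig_kernel_bounded p q y)).
Qed.

Let rconvE p q y u v : rintegrable mu u -> rintegrable mu v ->
  \int[mumu]_z (trig_kernel p q y z.1 * conv_kernel u v z) = rconv p q y u v.
Proof.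
move=> iu iv.
have mk := measurable_trig_kernel p q y; have bk := trig_kernel_bounded p q y.
rewrite (Rintegral_conv_kernel mk bk iu iv).
pose c p q := rtrig p q y v.
have E (z : plane) : \int[mu]_x (trig_kernel p q y (x.1 + z.1, x.2 + z.2) * v x) =
    trig_kernel p q y z * c false false
    + (-1) ^+ (~~ q) * trig_kernel p (~~ q) y z * c false true
    + (-1) ^+ (~~ p) * trig_kernel (~~ p) q y z * c true false
    + (-1) ^+ (~~ p) * (-1) ^+ (~~ q) * trig_kernel (~~ p) (~~ q) y z * c true true.
  rewrite -Rintegral_lin4; [|exact: rintegrable_trig..].
  by apply: eq_Rintegral => x _; rewrite trig_kernelD; ring.
under eq_Rintegral do rewrite E.
transitivity (\int[mu]_z (c false false * (trig_kernel p q y z * u z)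
    + ((-1) ^+ (~~ q) * c false true) * (trig_kernel p (~~ q) y z * u z)
    + ((-1) ^+ (~~ p) * c true false) * (trig_kernel (~~ p) q y z * u z)
    + ((-1) ^+ (~~ p) * (-1) ^+ (~~ q) * c true true) *
        (trig_kernel (~~ p) (~~ q) y z * u z))).
  by apply: eq_Rintegral => z _; ring.
rewrite Rintegral_lin4; [|exact: rintegrable_trig..].
by rewrite /rconv -!/(rtrig _ _ _ _) /c; ring.
Qed.

(** The four kernels stay under one integral: the section of a single kernel is integrable for
    almost every x only, so splitting the inner integral could fail at some points. *)
Let rconv_lin4 p q y (c1 c2 c3 c4 : R) (u1 u2 u3 u4 v1 v2 v3 v4 : plane -> R)
    (K := fun z => c1 * conv_kernel u1 v1 z + c2 * conv_kernel u2 v2 z +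
                   c3 * conv_kernel u3 v3 z + c4 * conv_kernel u4 v4 z) :
  rintegrable mu u1 -> rintegrable mu u2 -> rintegrable mu u3 -> rintegrable mu u4 ->
  rintegrable mu v1 -> rintegrable mu v2 -> rintegrable mu v3 -> rintegrable mu v4 ->
  rintegrable mu (fun x => \int[mu]_z K (x, z)) /\
  \int[mu]_x (trig_kernel p q y x * \int[mu]_z K (x, z)) =
    c1 * rconv p q y u1 v1 + c2 * rconv p q y u2 v2 +
    c3 * rconv p q y u3 v3 + c4 * rconv p q y u4 v4.
Proof.
move=> i1 i2 i3 i4 j1 j2 j3 j4.
have iK : rintegrable mumu K.
  by apply: rintegrable_lin4; exact: rintegrable_conv_kernel.
split; first exact: rintegrable_partial.
have mk := measurable_trig_kernel p q y; have bk := trig_kernel_bounded p q y.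
rewrite (Rintegral_partial mk bk iK) -!rconvE//.
have ik u v : rintegrable mu u -> rintegrable mu v ->
    rintegrable mumu (fun z => trig_kernel p q y z.1 * conv_kernel u v z).
  by move=> iu iv; apply: bounded_fst => //; exact: rintegrable_conv_kernel.
rewrite -Rintegral_lin4; [|exact: ik..].
by apply: eq_Rintegral => z _; rewrite /K; ring.
Qed.

Let qconv_comp f g :
  [/\ (fun x => qre (qconv f g x)) = (fun x => \int[mu]_z
         (fun w => 1 * conv_kernel (@qre R \o f) (@qre R \o g) w + -1 * conv_kernel (@qi R \o f) (@qi R \o g) w
           + -1 * conv_kernel (@qj R \o f) (@qj R \o g) w + -1 * conv_kernel (@qk R \o f) (@qk R \o g) w) (x, z)),
      (fun x => qi (qconv f g x)) = (fun x => \int[mu]_z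
         (fun w => 1 * conv_kernel (@qre R \o f) (@qi R \o g) w + 1 * conv_kernel (@qi R \o f) (@qre R \o g) w
           + 1 * conv_kernel (@qj R \o f) (@qk R \o g) w + -1 * conv_kernel (@qk R \o f) (@qj R \o g) w) (x, z)),
      (fun x => qj (qconv f g x)) = (fun x => \int[mu]_z
         (fun w => 1 * conv_kernel (@qre R \o f) (@qj R \o g) w + -1 * conv_kernel (@qi R \o f) (@qk R \o g) w
           + 1 * conv_kernel (@qj R \o f) (@qre R \o g) w + 1 * conv_kernel (@qk R \o f) (@qi R \o g) w) (x, z)) &
      (fun x => qk (qconv f g x)) = (fun x => \int[mu]_z
         (fun w => 1 * conv_kernel (@qre R \o f) (@qk R \o g) w + 1 * conv_kernel (@qi R \o f) (@qj R \o g) w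
           + -1 * conv_kernel (@qj R \o f) (@qi R \o g) w + 1 * conv_kernel (@qk R \o f) (@qre R \o g) w) (x, z))].
Proof.
by split; apply/funext => x; apply: eq_Rintegral => z _; rewrite /conv_kernel /=; ring.
Qed.

Lemma qintegrable_qconv f g : qintegrable f -> qintegrable g -> qintegrable (qconv f g).
Proof.
have [E0 E1 E2 E3] := qconv_comp f g.
move=> /qintegrable_comp[f0 f1 f2 f3] /qintegrable_comp[g0 g1 g2 g3].
have i0 : rintegrable mu (fun x => qre (qconv f g x)).
  by rewrite E0; have [] := rconv_lin4 false false 0 1 (-1) (-1) (-1) f0 f1 f2 f3 g0 g1 g2 g3.
have i1 : rintegrable mu (fun x => qi (qconv f g x)).
  by rewrite E1; have [] := rconv_lin4 false false 0 1 1 1 (-1) f0 f1 f2 f3 g1 g0 g3 g2.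
have i2 : rintegrable mu (fun x => qj (qconv f g x)).
  by rewrite E2; have [] := rconv_lin4 false false 0 1 (-1) 1 1 f0 f1 f2 f3 g2 g3 g0 g1.
have i3 : rintegrable mu (fun x => qk (qconv f g x)).
  by rewrite E3; have [] := rconv_lin4 false false 0 1 1 (-1) 1 f0 f1 f2 f3 g3 g2 g1 g0.
by split.
Qed.

Lemma qtrig_qconv p q f g y : qintegrable f -> qintegrable g ->
  qtrig p q (qconv f g) y =
    qtrig p q f y * qtrig false false g y
    + (-1) ^+ (~~ q) *: (qtrig p (~~ q) f y * qtrig false true g y)
    + (-1) ^+ (~~ p) *: (qtrig (~~ p) q f y * qtrig true false g y)
    + (-1) ^+ (~~ p) *: ((-1) ^+ (~~ q) *:
        (qtrig (~~ p) (~~ q) f y * qtrig true true g y)).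
Proof.
have [E0 E1 E2 E3] := qconv_comp f g.
move=> /qintegrable_comp[f0 f1 f2 f3] /qintegrable_comp[g0 g1 g2 g3].
have [_ H0] := rconv_lin4 p q y 1 (-1) (-1) (-1) f0 f1 f2 f3 g0 g1 g2 g3.
have [_ H1] := rconv_lin4 p q y 1 1 1 (-1) f0 f1 f2 f3 g1 g0 g3 g2.
have [_ H2] := rconv_lin4 p q y 1 (-1) 1 1 f0 f1 f2 f3 g2 g3 g0 g1.
have [_ H3] := rconv_lin4 p q y 1 1 (-1) 1 f0 f1 f2 f3 g3 g2 g1 g0.
have W (u v : plane -> R) : u = v ->
    \int[mu]_x (trig_kernel p q y x * u x) = \int[mu]_x (trig_kernel p q y x * v x).
  by move->.
have T r s h : qtrig r s h y = Quat (rtrig r s y (@qre R \o h)) (rtrig r s y (@qi R \o h))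
    (rtrig r s y (@qj R \o h)) (rtrig r s y (@qk R \o h)) by [].
rewrite !T; apply: quatP.
- apply: (etrans (W _ _ E0)); apply: (etrans H0).
  by rewrite /rconv /=; move: rtrig => r; ring.
- apply: (etrans (W _ _ E1)); apply: (etrans H1).
  by rewrite /rconv /=; move: rtrig => r; ring.
- apply: (etrans (W _ _ E2)); apply: (etrans H2).
  by rewrite /rconv /=; move: rtrig => r; ring.
- apply: (etrans (W _ _ E3)); apply: (etrans H3).
  by rewrite /rconv /=; move: rtrig => r; ring.
Qed.

End quaternion_convolution.

(** * The quaternion Fourier transform and its injectivity *)

Section quaternion_fourier.
Variable R : realType.
Notation plane := (measurableTypeR R * measurableTypeR R)%type.
Implicit Types (f g h : plane -> quat R) (m n : quat R) (y : R * R) (p q : bool).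

(** The expansion of (cos - m sin)(cos - n sin) f under the integral. Without the factor 1/(2 pi), a
    Mustard convolution is transformed into a plain product. *)
Definition qft m n f y := qtrig false false f y - n * qtrig false true f y
  - m * qtrig true false f y + m * (n * qtrig true true f y).

Lemma qfourierE m n f y : qintegrable f ->
  qfourier m n f y = (2 * pi)^-1 *: qft m n f y.
Proof.
move=> If; congr (_ *: _).
have I p q := qintegrable_trig p q y If.
have L (c : quat R) p q := qintegrable_lmulq c (I p q).
rewrite /qft /qtrig -!mulNr mulrA -!qintegral_lmulq//.
rewrite -!qintegralD//; [|by do ?apply: qintegrableD..].
congr qintegral; apply/funext => x.
rewrite -[RHS]/(_ *: f x + - n * (_ *: f x) + - m * (_ *: f x) + m * n * (_ *: f x)).
rewrite /qexp /trig_kernel /= !cosN !sinN.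
move: (cos _) (cos _) (sin _) (sin _) (f x) => c1 c2 s1 s2 fx.
by apply: quatP => /=; ring.
Qed.

Lemma qftD m n f g y : qintegrable f -> qintegrable g ->
  qft m n (f + g) y = qft m n f y + qft m n g y.
Proof.
move=> If Ig; rewrite /qft !qtrigD// !mulrDr !opprD.
by do 3 (rewrite [RHS]addrACA; congr (_ + _)).
Qed.

Lemma qftZ m n (c : R) f y : qintegrable f -> qft m n (c *: f) y = c *: qft m n f y.
Proof.
by move=> If; rewrite /qft !qtrigZ// -!scalerAr -!scalerBr -scalerDr.
Qed.

Lemma qftN m n f y : qintegrable f -> qft m n (- f) y = - qft m n f y.
Proof. by move=> If; rewrite -scaleN1r qftZ// scaleN1r. Qed.

Lemma qtrig_sign p q f a b y : qintegrable f ->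
  qtrig p q f ((-1) ^+ a * y.1, (-1) ^+ b * y.2) =
  (-1) ^+ (p * a + q * b) *: qtrig p q f y.
Proof.
move=> If; rewrite -qintegralZ; last exact: qintegrable_trig.
congr qintegral; apply/funext => x.
rewrite -[RHS]/(_ *: (trig_kernel _ _ _ _ *: f _)) scalerA; congr (_ *: _).
rewrite /trig_kernel/= ![_ * ((-1) ^+ _ * _)]mulrCA !trig_signM exprD.
by rewrite mulrACA.
Qed.

Lemma quat_sqrN1_inj n (u v : quat R) : n ^+ 2 = -1 -> n * u = n * v -> u = v.
Proof.
move=> hn E; apply: oppr_inj; rewrite -[- u]mulN1r -[- v]mulN1r -hn expr2.
by rewrite -!mulrA E.
Qed.

(** The columns of the sign matrix are orthogonal with squared norm 4, so each unknown is a quarter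
    of the sum of the equations weighted by its own signs. *)
Lemma quat_sign_system (A B C D : quat R) :
  A - B - C + D = 0 -> A + B - C - D = 0 -> A - B + C - D = 0 -> A + B + C + D = 0 ->
  [/\ A = 0, B = 0, C = 0 & D = 0].
Proof.
move=> E1 E2 E3 E4.
have solve x (c1 c2 c3 c4 : R) :
    x = 4^-1 *: (c1 *: (A - B - C + D) + c2 *: (A + B - C - D)
                 + c3 *: (A - B + C - D) + c4 *: (A + B + C + D)) -> x = 0.
  by rewrite E1 E2 E3 E4 !scaler0 !addr0 scaler0.
split.
- by apply: (solve _ 1 1 1 1); apply: quatP => /=; field.
- by apply: (solve _ (-1) 1 (-1) 1); apply: quatP => /=; field.
- by apply: (solve _ (-1) (-1) 1 1); apply: quatP => /=; field.
- by apply: (solve _ 1 (-1) (-1) 1); apply: quatP => /=; field.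
Qed.

Lemma qft_eq0 m n f : m ^+ 2 = -1 -> n ^+ 2 = -1 -> qintegrable f ->
  (forall y, qft m n f y = 0) -> forall p q y, qtrig p q f y = 0.
Proof.
move=> hm hn If F0 p q y.
pose A := qtrig false false f y; pose B := n * qtrig false true f y.
pose C := m * qtrig true false f y; pose D := m * (n * qtrig true true f y).
have E1 : A - B - C + D = 0 by exact: F0.
have E2 : A + B - C - D = 0.
  have := F0 ((-1) ^+ 0 * y.1, (-1) ^+ 1 * y.2); rewrite /qft !qtrig_sign//=.
  by rewrite !expr0 !expr1 !scale1r !scaleN1r !mulrN opprK.
have E3 : A - B + C - D = 0.
  have := F0 ((-1) ^+ 1 * y.1, (-1) ^+ 0 * y.2); rewrite /qft !qtrig_sign//=.
  by rewrite !expr0 !expr1 !scale1r !scaleN1r !mulrN opprK.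
have E4 : A + B + C + D = 0.
  have := F0 ((-1) ^+ 1 * y.1, (-1) ^+ 1 * y.2); rewrite /qft !qtrig_sign//=.
  by rewrite !expr0 !expr1 !expr2 !mulN1r opprK !scale1r !scaleN1r !mulrN !opprK.
have [A0 B0 C0 D0] := quat_sign_system E1 E2 E3 E4.
case: p; case: q.
- by apply: (quat_sqrN1_inj hn); apply: (quat_sqrN1_inj hm); rewrite !mulr0; exact: D0.
- by apply: (quat_sqrN1_inj hm); rewrite !mulr0; exact: C0.
- by apply: (quat_sqrN1_inj hn); rewrite !mulr0; exact: B0.
- exact: A0.
Qed.

Lemma trig_null_ae (u : plane -> R) : rintegrable (leb2 R) u ->
  (forall p q y, \int[leb2 R]_x (trig_kernel p q y x * u x) = 0) ->
  {ae leb2 R, forall x, u x = 0}.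
Proof.
move=> iu u0; apply: fourier_null_ae; split => // a b c.
(* The addition formulas expand cos(a x1 + b x2 + c) into the four kernels at the frequency (a,
   b). *)
have E : (fun x => cos (phase a b c x) * u x) = (fun x : plane =>
    cos c * (trig_kernel false false (a, b) x * u x)
    + - cos c * (trig_kernel true true (a, b) x * u x)
    + - sin c * (trig_kernel true false (a, b) x * u x)
    + - sin c * (trig_kernel false true (a, b) x * u x)).
  apply/funext => x; rewrite /phase /trig_kernel /= ![_ * x.1]mulrC ![_ * x.2]mulrC.
  by rewrite cosD [cos (_ + _)]cosD [sin (_ + _)]sinD; ring.
have iK p q : rintegrable (leb2 R) (fun x => trig_kernel p q (a, b) x * u x).
  apply: rintegrable_bounded => //; last exact: trig_kernel_bounded.
  exact: measurable_trig_kernel.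
by rewrite E Rintegral_lin4// !u0 !mulr0 !addr0.
Qed.

Lemma qfourier_inj m n f g : m ^+ 2 = -1 -> n ^+ 2 = -1 ->
  qintegrable f -> qintegrable g -> (forall y, qft m n f y = qft m n g y) ->
  f = g %[ae leb2 R].
Proof.
move=> hm hn If Ig E.
have Id : qintegrable (f - g) by apply: qintegrableD => //; exact: qintegrableN.
have d0 : forall p q y, qtrig p q (f - g) y = 0.
  apply: (qft_eq0 hm hn Id) => y; rewrite qftD//; last exact: qintegrableN.
  by rewrite qftN// E subrr.
have [i0 i1 i2 i3] := qintegrable_comp Id.
have a0 := trig_null_ae i0 (fun p q y => congr1 (@qre R) (d0 p q y)).
have a1 := trig_null_ae i1 (fun p q y => congr1 (@qi R) (d0 p q y)).
have a2 := trig_null_ae i2 (fun p q y => congr1 (@qj R) (d0 p q y)).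
have a3 := trig_null_ae i3 (fun p q y => congr1 (@qk R) (d0 p q y)).
apply: filterS2 (filterI a0 a1) (filterI a2 a3) => x [x0 x1] [x2 x3] _.
by apply: subr0_eq; exact: quatP.
Qed.

End quaternion_fourier.

(** * Existence of Mustard convolutions *)

Section mustard_convolution.
Variable R : realType.
Notation plane := (measurableTypeR R * measurableTypeR R)%type.
Implicit Types (f g h : plane -> quat R) (y : R * R) (p q : bool).

(** The imaginary components of the square are 2 m0 mi. If m0 were nonzero, all mi would vanish,
    leaving m0^2 = -1. *)
Lemma qre_sqrN1 (m : quat R) : m ^+ 2 = -1 -> qre m = 0.
Proof.
rewrite expr2; case: m => m0 m1 m2 m3 E.
have /= E0 := congr1 (@qre R) E; have /= E1 := congr1 (@qi R) E.
have /= E2 := congr1 (@qj R) E; have /= E3 := congr1 (@qk R) E => /=.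
apply/eqP/negPn/negP => m00.
have z t : m0 * t = 0 -> t = 0 by move/eqP; rewrite mulf_eq0 (negPf m00) => /eqP.
have t1 : m1 = 0 by apply: z; lra.
have t2 : m2 = 0 by apply: z; lra.
have t3 : m3 = 0 by apply: z; lra.
by move: E0; rewrite t1 t2 t3; have := sqr_ge0 m0; rewrite expr2; lra.
Qed.

(** Both factors are purely imaginary, so the imaginary part of their product is a cross product and
    changes sign when they are swapped. *)
Lemma anticommutator_real (m n : quat R) : m ^+ 2 = -1 -> n ^+ 2 = -1 ->
  m * n + n * m = (qre (m * n + n * m))%:A.
Proof.
move=> /qre_sqrN1 hm /qre_sqrN1 hn.
by apply: quatP => /=; rewrite ?hm ?hn; ring.
Qed.

Definition parity_part p q g : plane -> quat R :=
  4^-1 *: (g + (-1) ^+ q *: reflection 0 1 g + (-1) ^+ p *: reflection 1 0 g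
             + (-1) ^+ (p + q) *: reflection 1 1 g).

Lemma qintegrable_parity_part p q g : qintegrable g -> qintegrable (parity_part p q g).
Proof.
move=> Ig; apply: qintegrableZ; do !apply: qintegrableD => //;
  by apply: qintegrableZ; exact: qintegrable_reflection.
Qed.

(** Reflections act on the transform by signs, and averaging these gives 1 for matching parities and
    0 otherwise. *)
Lemma qtrig_parity_part p q p' q' g y : qintegrable g ->
  qtrig p' q' (parity_part p q g) y =
  if (p' == p) && (q' == q) then qtrig p' q' g y else 0.
Proof.
move=> Ig.
have I a b := qintegrable_reflection a b Ig.
have IZ c a b := qintegrableZ c (I a b).
rewrite qtrigZ; last by do !apply: qintegrableD.
rewrite !qtrigD//; try by do ?apply: qintegrableD.
rewrite !qtrigZ// !qtrig_reflection//.
move: (qtrig _ _ _ _) => t.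
by case: p; case: q; case: p'; case: q' => /=;
  rewrite ?expr0 ?expr1 ?expr2; apply: quatP => /=; field.
Qed.

(** Only the term of [qtrig_qconv] with the parities of the second factor survives. *)
Lemma qtrig_qconv_parity p q p' q' f g y : qintegrable f -> qintegrable g ->
  qtrig p q (qconv f (parity_part p' q' g)) y =
  (-1) ^+ ((~~ p && p') (+) (~~ q && q')) *:
    (qtrig (p (+) p') (q (+) q') f y * qtrig p' q' g y).
Proof.
move=> If Ig; rewrite qtrig_qconv//; last exact: qintegrable_parity_part.
rewrite !qtrig_parity_part//.
by case: p'; case: q'; case: p; case: q;
  rewrite /= ?mulr0 ?scaler0 ?addr0 ?add0r ?expr0 ?expr1 ?scale1r// scalerA mulN1r opprK scale1r.
Qed.

Definition odd_part2 f : plane -> quat R := 2^-1 *: (f - reflection 0 1 f).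

Lemma qintegrable_odd_part2 f : qintegrable f -> qintegrable (odd_part2 f).
Proof.
move=> If; apply/qintegrableZ/qintegrableD => //.
by apply/qintegrableN/qintegrable_reflection.
Qed.

Lemma qtrig_odd_part2 p q f y : qintegrable f ->
  qtrig p q (odd_part2 f) y = if q then qtrig p q f y else 0.
Proof.
move=> If; have I := qintegrable_reflection 0 1 If.
rewrite qtrigZ; last by apply: qintegrableD => //; exact: qintegrableN.
rewrite qtrigD//; last exact: qintegrableN.
rewrite qtrigN// qtrig_reflection// muln0 muln1 add0n.
move: (qtrig _ _ _ _) => t.
by case: q => /=; rewrite ?expr0 ?expr1; apply: quatP => /=; field.
Qed.

Lemma sqrN1_mulK (m t : quat R) : m ^+ 2 = -1 -> m * (m * t) = - t.
Proof. by move=> hm; rewrite mulrA -expr2 hm mulN1r. Qed.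

(** As a rewriting rule it moves m in front of n. Together with [sqrN1_mulK] it reduces every word
    applied to t to a combination of t, m t, n t and m n t. *)
Lemma anticommutatorE (m n : quat R) (a : R) (t : quat R) :
  m * n + n * m = a%:A -> n * (m * t) = a *: t - m * (n * t).
Proof. by move=> hmn; rewrite -[a *: t]mulr_algl -hmn mulrDl -!mulrA addrC addKr. Qed.

Variables (m n : quat R) (a : R).
Hypotheses (hm : m ^+ 2 = -1) (hn : n ^+ 2 = -1) (hmn : m * n + n * m = a%:A).

Let mm t := sqrN1_mulK t hm.
Let nn t := sqrN1_mulK t hn.
Let nm t := anticommutatorE t hmn.

Let scale_out (c : R) (x y : quat R) : x * (c *: y) = c *: (x * y).
Proof. by rewrite -scalerAr. Qed.

Let wordsE := (mm, nn, nm, scale_out, @mulrDr (quat R), @mulrBr (quat R),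
  @mulrN (quat R), @mulr0 (quat R)).

(* Once words in [m] and [n] are reduced, left multiplications are generalised to
   opaque functions, which leaves a linear identity over [R]. *)
Ltac word_lin := rewrite ?wordsE; move: ( *%R m) ( *%R n) => M N; apply: quatP => /=; field.

Lemma qft_conv_ee f g y : qintegrable f -> qintegrable g ->
  qft m n (qconv f (parity_part false false g)) y =
  qft m n f y * qtrig false false g y.
Proof.
move=> If Ig; rewrite /qft !qtrig_qconv_parity//= !expr0 !scale1r.
by rewrite !mulrDl !mulNr !mulrA.
Qed.

(** Convolving with a function odd in x2 replaces cos by -sin and sin by cos there, hence e^(-n x2
    y2) by -n e^(-n x2 y2). The n in front of f cancels -n. *)
Lemma qft_conv_eo f g y : qintegrable f -> qintegrable g ->
  qft m n (qconv (lmulq n f) (parity_part false true g)) y =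
  qft m n f y * qtrig false true g y.
Proof.
move=> If Ig; have In := qintegrable_lmulq n If.
rewrite /qft !qtrig_qconv_parity//= !qtrig_lmulq// ?expr0 ?expr1 !scale1r !scaleN1r.
rewrite !mulrDl !mulNr -!mulrA.
move: (qtrig false false f y * _) (qtrig false true f y * _)
  (qtrig true false f y * _) (qtrig true true f y * _) => A B C D.
by word_lin.
Qed.

(** Oddness in x1 produces the factor -m in front of e^(-n x2 y2). Since m e^(-n t) = e^(n t) m - a
    sin t, moving it to f conjugates the exponential, which the reflection of f undoes, and leaves a
    sine term, which the convolution with the odd part of f cancels. *)
Lemma qft_conv_oe f g y : qintegrable f -> qintegrable g ->
  qft m n (qconv (lmulq m (reflection 0 1 f)) (parity_part true false g)
           + - a *: qconv (lmulq n (odd_part2 f)) (parity_part true false g)) y =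
  qft m n f y * qtrig true false g y.
Proof.
move=> If Ig.
have Io := qintegrable_odd_part2 If; have Ir := qintegrable_reflection 0 1 If.
have I1 := qintegrable_lmulq m Ir; have I2 := qintegrable_lmulq n Io.
have Ip := qintegrable_parity_part true false Ig.
have J1 := qintegrable_qconv I1 Ip; have J2 := qintegrable_qconv I2 Ip.
rewrite qftD//; last exact: qintegrableZ.
rewrite qftZ// /qft !qtrig_qconv_parity//= !qtrig_lmulq// !qtrig_odd_part2//.
rewrite !qtrig_reflection//= ?muln0 ?muln1 ?addn0 ?add0n ?expr0 ?expr1 !scale1r !scaleN1r.
rewrite ?mulr0 ?mul0r !mulrDl !mulrN !mulNr -!mulrA.
move: (qtrig false false f y * _) (qtrig false true f y * _)
  (qtrig true false f y * _) (qtrig true true f y * _) => A B C D.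
by word_lin.
Qed.

(** Both factors -m and -n occur. The n of n m cancels -n, and m is then moved past the exponential
    as in [qft_conv_oe]. *)
Lemma qft_conv_oo f g y : qintegrable f -> qintegrable g ->
  qft m n (qconv (lmulq (n * m) (reflection 0 1 f)) (parity_part true true g)
           + a *: qconv (odd_part2 f) (parity_part true true g)) y =
  qft m n f y * qtrig true true g y.
Proof.
move=> If Ig.
have I2 := qintegrable_odd_part2 If; have Ir := qintegrable_reflection 0 1 If.
have I1 := qintegrable_lmulq (n * m) Ir.
have Ip := qintegrable_parity_part true true Ig.
have J1 := qintegrable_qconv I1 Ip; have J2 := qintegrable_qconv I2 Ip.
rewrite qftD//; last exact: qintegrableZ.
rewrite qftZ// /qft !qtrig_qconv_parity//= !qtrig_lmulq// !qtrig_odd_part2//.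
rewrite !qtrig_reflection//= ?muln0 ?muln1 ?addn0 ?add0n ?expr0 ?expr1 !scale1r !scaleN1r.
rewrite ?mulr0 ?mul0r !mulrDl !mulrN !mulNr -!mulrA.
move: (qtrig false false f y * _) (qtrig false true f y * _)
  (qtrig true false f y * _) (qtrig true true f y * _) => A B C D.
by word_lin.
Qed.
Lemma mustardP f g : qintegrable f -> qintegrable g ->
  qintegrable (f *_[m, n] g) /\
  forall y, qft m n (f *_[m, n] g) y = qft m n f y * qft m n g y.
Proof.
move=> If Ig.
have Ip p q c := qintegrable_parity_part p q (qintegrable_lmulq c Ig).
have Ir := qintegrable_reflection 0 1 If; have Io := qintegrable_odd_part2 If.
(* The four terms of F(g) carry the left factors 1, n, m and m n. These are absorbed into g, and
   each term then falls under one of the four preceding lemmas. *)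
pose h1 := qconv f (parity_part false false g).
pose h2 := qconv (lmulq n f) (parity_part false true (lmulq n g)).
pose h3 := qconv (lmulq m (reflection 0 1 f)) (parity_part true false (lmulq m g))
  + - a *: qconv (lmulq n (odd_part2 f)) (parity_part true false (lmulq m g)).
pose h4 := qconv (lmulq (n * m) (reflection 0 1 f)) (parity_part true true (lmulq (m * n) g))
  + a *: qconv (odd_part2 f) (parity_part true true (lmulq (m * n) g)).
have I1 : qintegrable h1 by apply: qintegrable_qconv => //; exact: qintegrable_parity_part.
have I2 : qintegrable h2 by apply: qintegrable_qconv => //; exact: qintegrable_lmulq.
have I3 : qintegrable h3.
  apply: qintegrableD; last apply: qintegrableZ; apply: qintegrable_qconv => //;
  exact: qintegrable_lmulq.
have I4 : qintegrable h4.
  apply: qintegrableD; last apply: qintegrableZ; apply: qintegrable_qconv => //;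
  exact: qintegrable_lmulq.
have I12 := qintegrableD I1 (qintegrableN I2).
have I123 := qintegrableD I12 (qintegrableN I3).
have Ih := qintegrableD I123 I4.
have hE y : qft m n (h1 + - h2 + - h3 + h4) y = qft m n f y * qft m n g y.
  rewrite (qftD _ _ _ I123 I4) (qftD _ _ _ I12 (qintegrableN I3)).
  rewrite (qftD _ _ _ I1 (qintegrableN I2)) !qftN//.
  have E1 : qft m n h1 y = _ := qft_conv_ee y If Ig.
  have E2 : qft m n h2 y = _ := qft_conv_eo y If (qintegrable_lmulq n Ig).
  have E3 : qft m n h3 y = _ := qft_conv_oe y If (qintegrable_lmulq m Ig).
  have E4 : qft m n h4 y = _ := qft_conv_oo y If (qintegrable_lmulq (m * n) Ig).
  rewrite E1 E2 E3 E4 !qtrig_lmulq//; move: (qft m n f y) => F.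
  by rewrite /qft mulrDr !mulrBr -(mulrA m n).
have [] : is_mustard m n f g (f *_[m, n] g); last first.
  move=> I E; split => // y; have := E y; rewrite !qfourierE//.
  rewrite -!scalerAl -!scalerAr !scalerA.
  move=> /(congr1 (fun t : quat R => (2 * pi) *: t)); rewrite !scalerA.
  have p0 : 2 * pi != 0 :> R by rewrite mulf_neq0// gt_eqF// pi_gt0.
  by rewrite mulfV// mul1r mulfV// !scale1r.
apply: xgetPex; exists (h1 + - h2 + - h3 + h4); split => // y.
rewrite !qfourierE// hE -!scalerAl -!scalerAr !scalerA.
have p0 : 2 * pi != 0 :> R by rewrite mulf_neq0// gt_eqF// pi_gt0.
by rewrite mulfV// mul1r.
Qed.

(** * Transforms of the two sides of the identity *)

Definition has_qft (h : plane -> quat R) (W : R * R -> quat R) :=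
  qintegrable h /\ forall y, qft m n h y = W y.

Lemma eq_has_qft h W W' : has_qft h W -> W =1 W' -> has_qft h W'.
Proof. by move=> [Ih hW] E; split => // y; rewrite hW E. Qed.

Lemma has_qftD h h' W W' : has_qft h W -> has_qft h' W' ->
  has_qft (h + h') (fun y => W y + W' y).
Proof.
move=> [Ih hW] [Ih' hW']; split; first exact: qintegrableD.
by move=> y; rewrite qftD// hW hW'.
Qed.

Lemma has_qftN h W : has_qft h W -> has_qft (- h) (fun y => - W y).
Proof.
move=> [Ih hW]; split; first exact: qintegrableN.
by move=> y; rewrite qftN// hW.
Qed.

Lemma has_qftZ (c : R) h W : has_qft h W -> has_qft (c *: h) (fun y => c *: W y).
Proof.
move=> [Ih hW]; split; first exact: qintegrableZ.
by move=> y; rewrite qftZ// hW.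
Qed.

Lemma has_qft_mustard f g : qintegrable f -> qintegrable g ->
  has_qft (f *_[m, n] g) (fun y => qft m n f y * qft m n g y).
Proof. exact: mustardP. Qed.

(** Since m n m n D = a m n D - D, the bracket with a/2 yields a term in a^2, which the last bracket
    cancels. *)
Lemma mustard_reduce (F1 F2 F3 F4 F5 F6 A B C D : quat R) :
  F1 * A + F2 * (n * (n * B)) + F3 * (m * (m * C)) + F4 * (m * (n * (n * m * D)))
  + (a / 2) *: (F5 * (m * (n * (m * n * D))) - F1 * (m * (n * (m * n * D)))
                + F6 * (m * (m * C)) - F2 * (m * (m * C)))
  + (a ^+ 2 / 2) *: (F1 * (m * (n * D)) - F5 * (m * (n * D))) =
  F1 * A - F2 * B - F3 * C + F4 * D
  + (a / 2) *: (F1 * D - F5 * D + F2 * C - F6 * C).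
Proof.
have nmD : m * (n * (n * m * D)) = D by rewrite -(mulrA n m D) nn mulrN mm opprK.
have mnD : m * (n * (m * n * D)) = a *: (m * (n * D)) - D.
  by rewrite -(mulrA m n D) nm nn mulrN opprK mulrDr scale_out mm.
rewrite nmD mnD !nn !mm; move: (m * (n * D)) => X.
rewrite !mulrBr !mulrN !scale_out.
move: ( *%R F1) ( *%R F2) ( *%R F3) ( *%R F4) ( *%R F5) ( *%R F6) => G1 G2 G3 G4 G5 G6.
by apply: quatP => /=; field.
Qed.

(** For each parity of g, the factors -n and -m are moved past e^(-n x2 y2) to f. Passing m reflects
    f and leaves a multiple of a sin(x2 y2), and that sine is obtained by subtracting from a
    transform its value on the reflected function. *)
Lemma qft_qconv f g y (F := fun h => qft m n h y)
    (A := qtrig false false g y) (B := qtrig false true g y)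
    (C := qtrig true false g y) (D := qtrig true true g y) :
  qintegrable f -> qintegrable g ->
  F f * A - F (lmulq n f) * B - F (lmulq m (reflection 0 1 f)) * C
  + F (lmulq (m * n) (reflection 0 1 f)) * D
  + (a / 2) *: (F f * D - F (reflection 0 1 f) * D
                + F (lmulq n f) * C - F (lmulq n (reflection 0 1 f)) * C) =
  F (qconv f g).
Proof.
move=> If Ig; have Ir := qintegrable_reflection 0 1 If.
rewrite /F /qft !qtrig_qconv// !qtrig_lmulq// !qtrig_reflection//=.
rewrite !(muln0, muln1, addn0, add0n) !(expr0, expr1) !scale1r !scaleN1r -/A -/B -/C -/D.
rewrite {}/F; move: A B C D => A B C D.
move: (qtrig false false f y) (qtrig false true f y)
  (qtrig true false f y) (qtrig true true f y) => P Q S T.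
rewrite -!mulrA !mulrN !opprK.
rewrite ?wordsE.
have scale_outl (c : R) (x t : quat R) : (c *: x) * t = c *: (x * t) by rewrite scalerAl.
rewrite !(@mulrDl (quat R), @mulrBl (quat R), @mulNr (quat R), scale_outl) -!mulrA.
move: ( *%R P) ( *%R Q) ( *%R S) ( *%R T) ( *%R m) ( *%R n) => P' Q' S' T' M N.
by apply: quatP => /=; field.
Qed.

End mustard_convolution.

(* The F's are the transforms of the left factors; [ph], [qh], [rh], [sh] are the
   four terms, up to sign, of the transform of [h g] and its reflections, for
   [h] = 1, nu, mu, nu mu, mu nu. *)
Lemma mustard_rows (R : realType) (a : R) (F1 F2 F3 F4 F5 F6 : quat R)
    (p1 q1 r1 s1 pn qn rn sn pm qm rm sm pnm qnm rnm snm pmn qmn rmn smn : quat R) :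
    4^-1 *: (
       F1 * (p1 - q1 - r1 + s1)
       + F1 * (p1 + q1 - r1 - s1)
       + F1 * (p1 - q1 + r1 - s1)
       + F1 * (p1 + q1 + r1 + s1)
       - F2 * (pn - qn - rn + sn)
       + F2 * (pn + qn - rn - sn)
       - F2 * (pn - qn + rn - sn)
       + F2 * (pn + qn + rn + sn)
       - F3 * (pm - qm - rm + sm)
       - F3 * (pm + qm - rm - sm)
       + F3 * (pm - qm + rm - sm)
       + F3 * (pm + qm + rm + sm)
       + F4 * (pnm - qnm - rnm + snm)
       - F4 * (pnm + qnm - rnm - snm)
       - F4 * (pnm - qnm + rnm - snm)
       + F4 * (pnm + qnm + rnm + snm))
  + (a / 8) *: (
       - (F1 * (pmn - qmn - rmn + smn))
       + F2 * (pm - qm - rm + sm)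
       + F1 * (pmn + qmn - rmn - smn)
       + F2 * (pm + qm - rm - sm)
       + F1 * (pmn - qmn + rmn - smn)
       - F2 * (pm - qm + rm - sm)
       - F1 * (pmn + qmn + rmn + smn)
       - F2 * (pm + qm + rm + sm)
       + F5 * (pmn - qmn - rmn + smn)
       - F6 * (pm - qm - rm + sm)
       - F5 * (pmn + qmn - rmn - smn)
       - F6 * (pm + qm - rm - sm)
       - F5 * (pmn - qmn + rmn - smn)
       + F6 * (pm - qm + rm - sm)
       + F5 * (pmn + qmn + rmn + smn)
       + F6 * (pm + qm + rm + sm))
  + (a ^+ 2 / 8) *: (
       F1 * (p1 - q1 - r1 + s1)
       - F1 * (p1 + q1 - r1 - s1)
       - F1 * (p1 - q1 + r1 - s1)
       + F1 * (p1 + q1 + r1 + s1)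
       - F5 * (p1 - q1 - r1 + s1)
       + F5 * (p1 + q1 - r1 - s1)
       + F5 * (p1 - q1 + r1 - s1)
       - F5 * (p1 + q1 + r1 + s1))
  = F1 * p1 + F2 * qn + F3 * rm + F4 * snm
  + (a / 2) *: (F5 * smn - F1 * smn + F6 * rm - F2 * rm)
  + (a ^+ 2 / 2) *: (F1 * s1 - F5 * s1).
Proof.
have V00 (F p q r s : quat R) : F * (p - q - r + s) = F * p - F * q - F * r + F * s.
  by rewrite mulrDr !mulrBr.
have V01 (F p q r s : quat R) : F * (p + q - r - s) = F * p + F * q - F * r - F * s.
  by rewrite !mulrBr mulrDr.
have V10 (F p q r s : quat R) : F * (p - q + r - s) = F * p - F * q + F * r - F * s.
  by rewrite mulrBr mulrDr mulrBr.
have V11 (F p q r s : quat R) : F * (p + q + r + s) = F * p + F * q + F * r + F * s.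
  by rewrite !mulrDr.
rewrite !(V00, V01, V10, V11).
move: ( *%R F1) ( *%R F2) ( *%R F3) ( *%R F4) ( *%R F5) ( *%R F6) => G1 G2 G3 G4 G5 G6.
by apply: quatP => /=; field.
Qed.

Theorem theorem4p1 (R : realType) (mu nu : quat R)
    (hmu : mu ^+ 2 = -1) (hnu : nu ^+ 2 = -1)
    (f g : R * R -> quat R) (hf : qintegrable f) (hg : qintegrable g) :
  exists a : R, mu * nu + nu * mu = a%:A /\
  qconv f g =
    4^-1 *: (
       f *_[mu, nu] g
       + f *_[mu, nu] g^^(0, 1)
       + f *_[mu, nu] g^^(1, 0)
       + f *_[mu, nu] g^^(1, 1)
       - nu **: f *_[mu, nu] nu **: g
       + nu **: f *_[mu, nu] nu **: g^^(0, 1)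
       - nu **: f *_[mu, nu] nu **: g^^(1, 0)
       + nu **: f *_[mu, nu] nu **: g^^(1, 1)
       - mu **: f^^(0, 1) *_[mu, nu] mu **: g
       - mu **: f^^(0, 1) *_[mu, nu] mu **: g^^(0, 1)
       + mu **: f^^(0, 1) *_[mu, nu] mu **: g^^(1, 0)
       + mu **: f^^(0, 1) *_[mu, nu] mu **: g^^(1, 1)
       + (mu * nu) **: f^^(0, 1) *_[mu, nu] (nu * mu) **: g
       - (mu * nu) **: f^^(0, 1) *_[mu, nu] (nu * mu) **: g^^(0, 1)
       - (mu * nu) **: f^^(0, 1) *_[mu, nu] (nu * mu) **: g^^(1, 0)
       + (mu * nu) **: f^^(0, 1) *_[mu, nu] (nu * mu) **: g^^(1, 1))
  + (a / 8) *: (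
       - f *_[mu, nu] (mu * nu) **: g
       + nu **: f *_[mu, nu] mu **: g
       + f *_[mu, nu] (mu * nu) **: g^^(0, 1)
       + nu **: f *_[mu, nu] mu **: g^^(0, 1)
       + f *_[mu, nu] (mu * nu) **: g^^(1, 0)
       - nu **: f *_[mu, nu] mu **: g^^(1, 0)
       - f *_[mu, nu] (mu * nu) **: g^^(1, 1)
       - nu **: f *_[mu, nu] mu **: g^^(1, 1)
       + f^^(0, 1) *_[mu, nu] (mu * nu) **: g
       - nu **: f^^(0, 1) *_[mu, nu] mu **: g
       - f^^(0, 1) *_[mu, nu] (mu * nu) **: g^^(0, 1)
       - nu **: f^^(0, 1) *_[mu, nu] mu **: g^^(0, 1)
       - f^^(0, 1) *_[mu, nu] (mu * nu) **: g^^(1, 0)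
       + nu **: f^^(0, 1) *_[mu, nu] mu **: g^^(1, 0)
       + f^^(0, 1) *_[mu, nu] (mu * nu) **: g^^(1, 1)
       + nu **: f^^(0, 1) *_[mu, nu] mu **: g^^(1, 1))
  + (a ^+ 2 / 8) *: (
       f *_[mu, nu] g
       - f *_[mu, nu] g^^(0, 1)
       - f *_[mu, nu] g^^(1, 0)
       + f *_[mu, nu] g^^(1, 1)
       - f^^(0, 1) *_[mu, nu] g
       + f^^(0, 1) *_[mu, nu] g^^(0, 1)
       + f^^(0, 1) *_[mu, nu] g^^(1, 0)
       - f^^(0, 1) *_[mu, nu] g^^(1, 1))
  %[ae leb2 R].
Proof.
exists (qre (mu * nu + nu * mu)); split; first exact: anticommutator_real.
have hmn := anticommutator_real hmu hnu.
move: (qre _) hmn => a hmn.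
have Ic := qintegrable_qconv hf hg.
set H := (X in _ = X %[ae _]).
(* By injectivity, only integrability and the transform of the right-hand side remain to be
   found. *)
suff [IH EH] : has_qft mu nu H (qft mu nu (qconv f g)).
  by apply: (qfourier_inj hmu hnu Ic IH) => y; rewrite EH.
rewrite {}/H; apply: eq_has_qft => [|y].
  (* Following the shape of the sum proves integrability and builds its transform as an existential
     variable. *)
  repeat first [ apply: has_qftD | apply: has_qftN | apply: has_qftZ
    | (apply: (has_qft_mustard hmu hnu hmn);
       repeat first [ exact: hf | exact: hg | apply: qintegrable_lmulq
         | apply: qintegrable_reflection ]) ].
have If01 := qintegrable_reflection 0 1 hf.
have Ig a b := qintegrable_reflection a b hg.
set F1 := qft mu nu f y.
set F2 := qft mu nu (nu **: f) y.
set F3 := qft mu nu (mu **: f^^(0, 1)) y.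
set F4 := qft mu nu ((mu * nu) **: f^^(0, 1)) y.
set F5 := qft mu nu (f^^(0, 1)) y.
set F6 := qft mu nu (nu **: f^^(0, 1)) y.
set A := qtrig false false g y; set B := qtrig false true g y.
set C := qtrig true false g y; set D := qtrig true true g y.
(* Reflections of g change only the signs of the four terms; the left factor h ranges over the words
   in the statement. *)
have Q00 h : qft mu nu (h **: g) y =
    h * A - nu * (h * B) - mu * (h * C) + mu * (nu * (h * D)).
  by rewrite /qft !qtrig_lmulq.
have Q01 h : qft mu nu (h **: g^^(0, 1)) y =
    h * A + nu * (h * B) - mu * (h * C) - mu * (nu * (h * D)).
  rewrite /qft !qtrig_lmulq// !qtrig_reflection//= !(muln0, muln1, addn0, add0n).
  by rewrite expr0 expr1 !scale1r !scaleN1r !mulrN opprK.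
have Q10 h : qft mu nu (h **: g^^(1, 0)) y =
    h * A - nu * (h * B) + mu * (h * C) - mu * (nu * (h * D)).
  rewrite /qft !qtrig_lmulq// !qtrig_reflection//= !(muln0, muln1, addn0, add0n).
  by rewrite expr0 expr1 !scale1r !scaleN1r !mulrN opprK.
have Q11 h : qft mu nu (h **: g^^(1, 1)) y =
    h * A + nu * (h * B) + mu * (h * C) + mu * (nu * (h * D)).
  rewrite /qft !qtrig_lmulq// !qtrig_reflection//= !(muln0, muln1, addn0, add0n).
  by rewrite expr0 expr1 expr2 mulN1r opprK !scale1r !scaleN1r !mulrN !opprK.
have lmulq1 u : 1 **: u = u by apply/funext => x; rewrite /lmulq mul1r.
have R00 := Q00 1; have R01 := Q01 1; have R10 := Q10 1; have R11 := Q11 1.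
rewrite !lmulq1 !mul1r in R00 R01 R10 R11.
rewrite !(Q00, Q01, Q10, Q11, R00, R01, R10, R11).
(* The reflections are summed row by row, then the words are reduced, and the result is the
   transform of the classical convolution. *)
apply: etrans; first exact: mustard_rows.
apply: etrans; first exact: (mustard_reduce hmu hnu hmn).
exact: (qft_qconv hmu hnu hmn).
Qed.
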